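(* Let $\mathbb{K}$ be a field and $V$ a vector space over $\mathbb{K}$. For $f\in\mathrm{Nor}(V)$ generated by a normal generating tree $\sigma$ and $n\ge 0$, the element $\sigma\langle n\rangle\in V^{\otimes n}$ depends only on $f$ and not on the choice of $\sigma$, and the map $$\tilde\varphi\colon\mathrm{Nor}(V)\to\mathrm{Rep}_{\mathrm{BL}}(V),\qquad \tilde\varphi(f)\colon\mathbb{K}[X]\to TV,\quad X^n\mapsto\sigma\langle n\rangle,$$ is a well-defined linear map with $\pi_{\mathrm{BL}}\circ\tilde\varphi=\pi$, and is an isomorphism of coalgebras from $(\mathrm{Nor}(V),\delta,\varepsilon)$ to $(\mathrm{Rep}_{\mathrm{BL}}(V),\delta_{\mathrm{BL}},\varepsilon_{\mathrm{BL}})$.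
   Context: Here $\mathbb{K}$ is a field; all tensor products are over $\mathbb{K}$. $TV=\bigoplus_n V^{\otimes n}$ is the usual tensor algebra and $\mathbb{K}[X]$ the polynomial algebra, both graded by degree. Block--Leroux construction. A linear map $f\colon\mathbb{K}[X]\to TV$ is representative (in the sense of Block--Leroux) if it preserves degrees and there are finite families $(g_i)_{i\in I},(h_i)_{i\in I}$ of degree-preserving linear maps $\mathbb{K}[X]\to TV$ with $f(t\cdot u)=\sum_{i\in I}g_i(t)\cdot h_i(u)$ for all $t,u\in\mathbb{K}[X]$. $\mathrm{Rep}_{\mathrm{BL}}(V)$ is the space of these maps. It is a coalgebra with $\delta_{\mathrm{BL}}(f)=\sum_{i\in I}g_i\otimes h_i$ (the families may be chosen in $\mathrm{Rep}_{\mathrm{BL}}(V)$, and the result is independent of the choice), $\varepsilon_{\mathrm{BL}}(f)=f(1)\in\mathbb{K}$, and $\pi_{\mathrm{BL}}\colon\mathrm{Rep}_{\mathrm{BL}}(V)\to V$ is $\pi_{\mathrm{BL}}(f)=f(X)$. Grading trees. A grading tree is a finite full (ordered, rooted) binary tree: every node has exactly zero or two children (left, right). $\bullet$ is the one-node tree, $t\wedge u$ is the tree with a new root whose left and right subtrees are $t$ and $u$, and $\mathrm{leaf}(t)$ is the number of leaves. Tree-tensor algebra. For a module $W$ put $\hat T^tW=W^{\otimes \mathrm{leaf}(t)}$ and $\hat T W=\bigoplus_t \hat T^tW$ over all grading trees $t$, with $\hat\otimes\colon \hat T^tW\otimes\hat T^uW\to\hat T^{t\wedge u}W$ concatenation of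 tensors. $\hat T\mathbb{K}$ is identified with the free module on the set of grading trees. A homomorphism $f\colon\hat T\mathbb{K}\to\hat TW$ is tree-graded if $f(t)\in\hat T^tW$ for all $t$. Generating trees. A generating tree for $V$ is an infinite ordered rooted tree $\sigma$ such that each node has a finite even number $2n\ge 2$ of children ($n$ may depend on the node), named $\mathrm{L}(1),\dots,\mathrm{L}(n),\mathrm{R}(1),\dots,\mathrm{R}(n)$ from left to right, and each node is labelled by an element of $V\oplus\mathbb{K}$. A node is specified by a finite sequence $r$ of symbols $\mathrm{L}(i),\mathrm{R}(i)$ read from the root (a position sequence; the root is $\emptyset$). $\sigma\langle r\rangle$ is the label at $r$, and $\sigma{\downarrow}_r$ the subtree rooted at $r$. Generated homomorphisms. For a grading tree $t$ with leaves $p_1,\dots,p_n$ from left to right, write $p_k=\xi_{k,1}\cdots\xi_{k,m_k}$ with $\xi_{k,l}\in\{\mathrm{L},\mathrm{R}\}$ (the path from the root). To each inner node $q$ of $t$ assign a variable $\iota\langle q\rangle$ ranging over positive integers and put $r_k=\xi_{k,1}(\iota\langle\emptyset\rangle)\,\xi_{k,2}(\iota\langle\xi_{k,1}\rangle)\cdots\xi_{k,m_k}(\iota\langle\xi_{k,1}\cdots\xi_{k,m_k-1}\rangle)$. Sums $\sum_\iota$ are over all assignments such that every $r_k$ specifies a node of $\sigma$. The homomorphism generated by $\sigma$ is the tree-graded $f\colon\hat T\mathbb{K}\to\hat T(V\oplus\mathbb{K})$ with $f(\bullet)=\sigma\langle\emptyset\rangle$, $f(t)=\sum_\iota \sigma\langle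 r_1\rangle\otimes\cdots\otimes\sigma\langle r_n\rangle$. $\mathrm{Rep}(V)$ is the module of all homomorphisms generated by some generating tree for $V$. Normality. Let $\alpha_V,\alpha_{\mathbb{K}}$ be the projections of $V\oplus\mathbb{K}$ to $V$ and $\mathbb{K}$. A projection tuple is $\vec\alpha=(\alpha_1,\dots,\alpha_n)$ with each $\alpha_k\in\{\alpha_V,\alpha_{\mathbb{K}}\}$; $\deg(\vec\alpha)$ is the number of $\alpha_V$'s. For $n=\mathrm{leaf}(t)$ put $\sigma\langle t\mid\vec\alpha\rangle=\sum_\iota\alpha_1(\sigma\langle r_1\rangle)\otimes\cdots\otimes\alpha_n(\sigma\langle r_n\rangle)$, regarded as an element of $V^{\otimes\deg(\vec\alpha)}$. $\sigma$ is weakly normal if $\sigma\langle t\mid\vec\alpha\rangle=\sigma\langle u\mid\vec\beta\rangle$ for all grading trees $t,u$ and projection tuples of lengths $\mathrm{leaf}(t),\mathrm{leaf}(u)$ with $\deg(\vec\alpha)=\deg(\vec\beta)$; $\sigma$ is normal if $\sigma{\downarrow}_s$ is weakly normal for every position sequence $s$. $\mathrm{Nor}(V)\subseteq\mathrm{Rep}(V)$ is the submodule of homomorphisms generated by normal generating trees. For $\sigma$ normal and $n\ge0$, $\sigma\langle n\rangle\in V^{\otimes n}$ denotes the common value of $\sigma\langle t\mid\vec\alpha\rangle$ over all $t$ and all $\vec\alpha$ of length $\mathrm{leaf}(t)$ with $\deg(\vec\alpha)=n$. Structure maps of $\mathrm{Nor}(V)$. If $f$ is generated by a normal $\sigma$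 whose root has $2m$ children, $\delta(f)=\sum_{i=1}^m g_i\otimes h_i$ with $g_i,h_i$ generated by $\sigma{\downarrow}_{\mathrm{L}(i)},\sigma{\downarrow}_{\mathrm{R}(i)}$ (independent of $\sigma$); $\varepsilon(f),\pi(f)$ are the $\mathbb{K}$- and $V$-components of $f(\bullet)$. With these, $\mathrm{Nor}(V)$ is a coalgebra. *)

(* Defs.v *)
From HB Require Import structures.
From mathcomp Require Import all_boot all_order all_algebra.
From mathcomp Require Import ring_quotient generic_quotient.
From mathcomp Require Import boolp classical_sets functions.
From mathcomp Require Import cardinality fsbigop.

Set Implicit Arguments.
Unset Strict Implicit.
Unset Printing Implicit Defensive.

Import GRing.Theory.
Local Open Scope classical_set_scope.
Local Open Scope ring_scope.

Section DirectSum.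
Context {K : fieldType} {I : choiceType}.
Implicit Types E : I -> lmodType K.

Definition dprod E : Type := forall i, E i.

Section DProd.
Context {E : I -> lmodType K}.
Implicit Types f g h : dprod E.

HB.instance Definition _ := gen_eqMixin (dprod E).
HB.instance Definition _ := gen_choiceMixin (dprod E).

Let add f g : dprod E := fun i => f i + g i.
Let zero : dprod E := fun=> 0.
Let opp f : dprod E := fun i => - f i.
Let scale (a : K) f : dprod E := fun i => a *: f i.

Fact dprod_addA : associative add.
Proof. by move=> f g h; apply: functional_extensionality_dep => i; exact: addrA. Qed.
Fact dprod_addC : commutative add.
Proof. by move=> f g; apply: functional_extensionality_dep => i; exact: addrC. Qed.
Fact dprod_add0 : left_id zero add.
Proof. by move=> f; apply: functional_extensionality_dep => i; exact: add0r. Qed.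
Fact dprod_addN : left_inverse zero opp add.
Proof. by move=> f; apply: functional_extensionality_dep => i; exact: addNr. Qed.
HB.instance Definition _ :=
  GRing.isZmodule.Build (dprod E) dprod_addA dprod_addC dprod_add0 dprod_addN.

Fact dprod_scaleA a b f : scale a (scale b f) = scale (a * b) f.
Proof. by apply: functional_extensionality_dep => i; exact: scalerA. Qed.
Fact dprod_scale1 : left_id 1 scale.
Proof. by move=> f; apply: functional_extensionality_dep => i; exact: scale1r. Qed.
Fact dprod_scaleDr : right_distributive scale +%R.
Proof. by move=> a f g; apply: functional_extensionality_dep => i; exact: scalerDr. Qed.
Fact dprod_scaleDl f : {morph scale^~ f : a b / a + b}.
Proof. by move=> a b; apply: functional_extensionality_dep => i; exact: scalerDl. Qed.
HB.instance Definition _ := GRing.Zmodule_isLmodule.Build K (dprod E)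
  dprod_scaleA dprod_scale1 dprod_scaleDr dprod_scaleDl.

Definition fin_supp : {pred dprod E} :=
  fun f => `[< finite_set [set i | f i != 0] >].

Fact fin_supp_closed : submod_closed fin_supp.
Proof.
split; first by apply/asboolP; rewrite (_ : [set _ | _] = set0) //;
  apply/seteqP; split=> i //=; rewrite eqxx.
move=> a f g /asboolP Hf /asboolP Hg; apply/asboolP.
have /sub_finite_set : [set i | (a *: f + g) i != 0] `<=`
   [set i | f i != 0] `|` [set i | g i != 0].
  move=> i /=; apply: contraNP => /not_orP [/negP/negPn/eqP fi /negP/negPn/eqP gi].
  have -> : (a *: f + g) i = a *: f i + g i by [].
  by rewrite fi gi scaler0 addr0.
by apply; rewrite finite_setU.
Qed.
HB.instance Definition _ :=
  GRing.isSubmodClosed.Build K (dprod E) fin_supp fin_supp_closed.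

End DProd.

Identity Coercion fun_of_dprod : dprod >-> Funclass.

(* The direct sum: finitely supported families. *)
Record dsum E := DSum { dcomp :> dprod E; _ : dcomp \in fin_supp }.

HB.instance Definition _ E := [isSub for @dcomp E].
HB.instance Definition _ E := [Choice of dsum E by <:].
HB.instance Definition _ E := [SubChoice_isSubLmodule of dsum E by <:].

Section DSumTheory.
Context {E : I -> lmodType K}.
Implicit Types x y : dsum E.

Lemma dsumP x y : (forall i, x i = y i) -> x = y.
Proof. by move=> xy; apply/val_inj/functional_extensionality_dep. Qed.

Lemma dsum0E i : (0 : dsum E) i = 0. Proof. by []. Qed.
Lemma dsumDE x y i : (x + y) i = x i + y i. Proof. by []. Qed.
Lemma dsumNE x i : (- x) i = - x i. Proof. by []. Qed.
Lemma dsumZE a x i : (a *: x) i = a *: x i. Proof. by []. Qed.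

Lemma dsum_sumE J (r : seq J) (P : pred J) (F : J -> dsum E) i :
  (\sum_(k <- r | P k) F k) i = \sum_(k <- r | P k) F k i.
Proof. exact: (big_morph (fun x : dsum E => x i)). Qed.

Fact dsin_subproof i (v : E i) :
  (dfwith (0 : dprod E) v : dprod E) \in fin_supp.
Proof.
apply/asboolP/(@sub_finite_set _ _ [set i]); last exact: finite_set1.
move=> j /=; apply: contraNP => /eqP ji; rewrite dfwith_out //.
by rewrite eq_sym.
Qed.
Definition dsin i (v : E i) : dsum E := DSum (dsin_subproof v).

Lemma dsin_in i (v : E i) : dsin v i = v.
Proof. exact: dfwith_in. Qed.
Lemma dsin_out i j (v : E i) : i != j -> dsin v j = 0.
Proof. exact: dfwith_out. Qed.

Fact dsin_is_linear i : linear (@dsin i).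
Proof.
move=> a u v; apply: dsumP => j; rewrite dsumDE dsumZE.
have [<-|ij] := eqVneq i j; first by rewrite !dsin_in.
by rewrite !dsin_out // scaler0 addr0.
Qed.
HB.instance Definition _ i :=
  GRing.isLinear.Build K (E i) (dsum E) *:%R (@dsin i) (@dsin_is_linear i).

Lemma dsin_inj i : injective (@dsin i).
Proof. by move=> u v /(congr1 (fun x : dsum E => x i)); rewrite !dsin_in. Qed.

(* The map out of the direct sum with components F; meaningful when every F i
   is linear. *)
Definition dlift (M : zmodType) (F : forall i, E i -> M) (x : dsum E) : M :=
  \sum_(i \in [set: I]) F i (x i).

Lemma dlift_seq (M : zmodType) (F : forall i, E i -> M) (r : seq I) x :
  (forall i, F i 0 = 0) -> uniq r -> (forall i, i \notin r -> x i = 0) ->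
  dlift F x = \sum_(i <- r) F i (x i).
Proof.
move=> F0 ur xr; rewrite /dlift (fsbigE r) //; last by move=> i _ ir; rewrite xr.
by apply: eq_bigl => i; rewrite in_setT.
Qed.

Lemma dsum_supp x : exists2 r : seq I, uniq r & forall i, i \notin r -> x i = 0.
Proof.
have /asboolP/finite_fsetP[r xr] : dcomp x \in fin_supp by case: x.
exists (finmap.enum_fset r); first exact: finmap.fset_uniq.
move=> i; apply: contraNeq => xi.
by have : [set i | x i != 0] i by []; rewrite xr.
Qed.

Lemma dlift_dsin (M : zmodType) (F : forall i, E i -> M) i (v : E i) :
  (forall i, F i 0 = 0) -> dlift F (dsin v) = F i v.
Proof.
move=> F0; rewrite (@dlift_seq _ _ [:: i]) ?big_seq1 ?dsin_in // => j.
by rewrite inE eq_sym => ij; rewrite dsin_out.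
Qed.

Lemma dlift_linear (M : lmodType K) (F : forall i, E i -> M) :
  (forall i, linear (F i)) -> linear (dlift F).
Proof.
move=> Fl a x y.
have F0 i : F i 0 = 0.
  by have := Fl i (-1) 0 0; rewrite scaler0 add0r scaleN1r addNr.
have [r ur xr] := dsum_supp x; have [s us ys] := dsum_supp y.
pose q := undup (r ++ s).
have out i : i \notin q -> x i = 0 /\ y i = 0.
  by rewrite mem_undup mem_cat negb_or => /andP[/xr ? /ys].
rewrite !(@dlift_seq _ _ q) ?undup_uniq //; try by move=> i /out[].
  rewrite scaler_sumr -big_split; apply: eq_bigr => i _.
  by rewrite dsumDE dsumZE Fl.
by move=> i /out[xi yi]; rewrite dsumDE dsumZE xi yi scaler0 addr0.
Qed.

Lemma dsum_ind (P : dsum E -> Prop) :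
  P 0 -> (forall x y, P x -> P y -> P (x + y)) ->
  (forall i v, P (@dsin i v)) -> forall x, P x.
Proof.
move=> P0 PD Pi x; have [r ur xr] := dsum_supp x.
suff -> : x = \sum_(i <- r) dsin (x i) by elim/big_ind: _.
apply: dsumP => j; rewrite dsum_sumE; have [jr|jr] := boolP (j \in r).
  rewrite (bigD1_seq j) //; rewrite dsin_in big1 ?[RHS]addr0 // => i ij.
  by rewrite dsin_out.
rewrite xr // big_seq big1 // => i ir; rewrite dsin_out //.
by apply: contraNneq jr => <-.
Qed.

End DSumTheory.
End DirectSum.

Section Tensor.
Context {K : fieldType}.

Definition free_prod (U W : lmodType K) : lmodType K :=
  dsum (fun _ : U * W => K^o).

Definition free_gen (U W : lmodType K) (u : U) (w : W) : free_prod U W :=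
  dsin (E := fun _ => K^o) (i := (u, w)) 1.

(* The submodule generated by the bilinearity relations; U (x) W is the quotient
   of the free module on U * W by it. *)
Inductive tens_null (U W : lmodType K) : free_prod U W -> Prop :=
| tens_null0 : tens_null 0
| tens_nullP a x y : tens_null x -> tens_null y -> tens_null (a *: x + y)
| tens_nullL a u u' w :
    tens_null (free_gen (a *: u + u') w - (a *: free_gen u w + free_gen u' w))
| tens_nullR a u w w' :
    tens_null (free_gen u (a *: w + w') - (a *: free_gen u w + free_gen u w')).

Section Quot.
Context (U W : lmodType K).

Definition tens_kernel : {pred free_prod U W} := fun x => `[< tens_null x >].

Fact tens_kernel_closed : submod_closed tens_kernel.
Proof.
split=> [|a x y /asboolP Hx /asboolP Hy]; first exact/asboolP/tens_null0.
exact/asboolP/tens_nullP.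
Qed.
HB.instance Definition _ := GRing.isSubmodClosed.Build K (free_prod U W)
  tens_kernel tens_kernel_closed.

Definition tensor_type : Type := Quotient.quot tens_kernel.
HB.instance Definition _ := GRing.Zmodule.on tensor_type.
HB.instance Definition _ := ZmodQuotient.on tensor_type.

Local Notation pi := (\pi_(Quotient.quot tens_kernel)%qT : free_prod U W -> tensor_type).

Lemma tens_piP (x y : free_prod U W) : pi x = pi y <-> tens_null (x - y).
Proof.
split=> [/eqP|H]; last apply/eqP; rewrite -Quotient.idealrBE //; first by move/asboolP.
exact/asboolP.
Qed.

Definition tens_scale (a : K) (q : tensor_type) : tensor_type := pi (a *: repr q).

Lemma tens_scaleE a x : tens_scale a (pi x) = pi (a *: x).
Proof.
have /tens_piP H : pi (repr (pi x)) = pi x by rewrite reprK.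
apply/tens_piP; rewrite -scalerBr.
by have := tens_nullP a H (tens_null0 U W); rewrite addr0.
Qed.

Lemma tens_reprP (q : tensor_type) : exists x, q = pi x.
Proof. by exists (repr q); rewrite reprK. Qed.

Fact tens_scaleA a b q : tens_scale a (tens_scale b q) = tens_scale (a * b) q.
Proof. by case: (tens_reprP q) => x ->; rewrite !tens_scaleE scalerA. Qed.
Fact tens_scale1 : left_id 1 tens_scale.
Proof. by move=> q; case: (tens_reprP q) => x ->; rewrite tens_scaleE scale1r. Qed.
Fact tens_scaleDr : right_distributive tens_scale +%R.
Proof.
move=> a p q; case: (tens_reprP p) => x ->; case: (tens_reprP q) => y ->.
by rewrite !tens_scaleE -!raddfD /= tens_scaleE scalerDr raddfD.
Qed.
Fact tens_scaleDl q : {morph tens_scale^~ q : a b / a + b}.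
Proof.
by move=> a b; case: (tens_reprP q) => x ->; rewrite !tens_scaleE scalerDl raddfD.
Qed.
HB.instance Definition _ := GRing.Zmodule_isLmodule.Build K tensor_type
  tens_scaleA tens_scale1 tens_scaleDr tens_scaleDl.

Definition tensor : lmodType K := tensor_type.

Lemma tens_piZ a x : (a *: pi x : tensor) = pi (a *: x).
Proof. exact: tens_scaleE. Qed.

Lemma tens_piD x y : (pi x + pi y : tensor) = pi (x + y).
Proof. by rewrite raddfD. Qed.

Definition tens (u : U) (w : W) : tensor := pi (free_gen u w).

(* The map u (x) w |-> b u w. It is computed on a chosen representative, hence
   meaningful only for bilinear b (tlift_tens, tlift_linear). *)
Definition tlift (M : lmodType K) (b : U -> W -> M) (z : tensor) : M :=
  dlift (fun p (c : K^o) => (c : K) *: b p.1 p.2)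
    (repr (z : tensor_type) : free_prod U W).

Lemma tens_linearl w : linear (tens^~ w).
Proof.
move=> a u v; rewrite /tens tens_piZ tens_piD.
exact/tens_piP/tens_nullL.
Qed.

Lemma tens_linearr u : linear (tens u).
Proof.
move=> a v w; rewrite /tens tens_piZ tens_piD.
exact/tens_piP/tens_nullR.
Qed.

Section Lift.
Context (M : lmodType K) (b : U -> W -> M).
Hypotheses (bl : forall w, linear (b^~ w)) (br : forall u, linear (b u)).

Let blift (x : free_prod U W) : M :=
  dlift (fun p (c : K^o) => (c : K) *: b p.1 p.2) x.

Let blift_linear : linear blift.
Proof. by apply: dlift_linear => p a c d; rewrite scalerDl -scalerA. Qed.

Let blift_gen u w : blift (free_gen u w) = b u w.
Proof. by rewrite /blift dlift_dsin ?scale1r // => p; rewrite scale0r. Qed.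

Lemma tlift_piE x : tlift b (pi x) = blift x.
Proof.
have blift0 : blift 0 = 0.
  have := blift_linear (-1) 0 0.
  by rewrite scaler0 addr0 scaleN1r addNr.
have bliftB p q : blift (p - q) = blift p - blift q.
  by have := blift_linear (-1) q p; rewrite !scaleN1r ![- _ + _]addrC.
have null y : tens_null y -> blift y = 0.
  elim=> [//|c p q _ Hp _ Hq|c u u' w|c u w w'].
  - by rewrite blift_linear Hp Hq scaler0 addr0.
  - by rewrite bliftB blift_linear !blift_gen bl subrr.
  - by rewrite bliftB blift_linear !blift_gen br subrr.
apply/eqP; rewrite -subr_eq0 -[tlift _ _]/(blift _) -bliftB; apply/eqP.
by apply/null/tens_piP; rewrite reprK.
Qed.

Lemma tlift_tens u w : tlift b (tens u w) = b u w.
Proof. by rewrite /tens tlift_piE blift_gen. Qed.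

Lemma tlift_linear : linear (tlift b).
Proof.
move=> a p q; case: (tens_reprP p) => x ->; case: (tens_reprP q) => y ->.
by rewrite tens_piZ tens_piD !tlift_piE blift_linear.
Qed.
End Lift.

Lemma tensor_ind (P : tensor -> Prop) :
  P 0 -> (forall x y, P x -> P y -> P (x + y)) ->
  (forall u w, P (tens u w)) -> forall z, P z.
Proof.
move=> P0 PD Pt z; case: (tens_reprP z) => x ->.
elim/(@dsum_ind K): x => [|x y Px Py|[u w] c].
- by rewrite raddf0.
- by rewrite raddfD; apply: PD.
rewrite (_ : dsin c = (c : K) *: free_gen u w); last first.
  by rewrite /free_gen -linearZ /= -[_ *: _]/((c : K) * 1) mulr1.
rewrite -tens_piZ.
have -> : c *: (pi (free_gen u w) : tensor) = tens ((c : K) *: u) w; last exact: Pt.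
have := tens_linearl w c u 0; rewrite addr0 => ->.
have := tens_linearl w (-1) 0 0; rewrite scaler0 addr0 scaleN1r addNr => ->.
by rewrite addr0.
Qed.

End Quot.
End Tensor.

Arguments tens {K U W}.
Arguments tlift {K U W M}.

Section LinearFacts.
Context {K : fieldType} {U W : lmodType K} (f : U -> W).
Hypothesis fl : linear f.

Lemma linear0E : f 0 = 0.
Proof. by have := fl (-1) 0 0; rewrite scaler0 addr0 scaleN1r addNr. Qed.
Lemma linearDE x y : f (x + y) = f x + f y.
Proof. by have := fl 1 x y; rewrite !scale1r. Qed.
Lemma linearZE a x : f (a *: x) = a *: f x.
Proof. by have := fl a x 0; rewrite linear0E !addr0. Qed.
Lemma linear_sumE J (r : seq J) (P : pred J) (F : J -> U) :
  f (\sum_(k <- r | P k) F k) = \sum_(k <- r | P k) f (F k).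
Proof. exact: (big_morph f linearDE linear0E). Qed.
End LinearFacts.

Section TensorPowers.
Context {K : fieldType} (V : lmodType K).

(* V^{(x) n} = V (x) (V (x) (... (x) K)). *)
Fixpoint tpow (n : nat) : lmodType K :=
  if n is n'.+1 then tensor V (tpow n') else K^o.

Fixpoint ptens n : n.-tuple V -> tpow n :=
  if n is n'.+1 then fun x => tens (thead x) (ptens [tuple of behead x])
  else fun=> (1 : K).

(* The identification of V (x) K, the first tensor power, with V. *)
Definition tpow1 : tpow 1 -> V := tlift (fun v (c : K^o) => (c : K) *: v).

Fixpoint tmul m n : tpow m -> tpow n -> tpow (m + n) :=
  if m is m'.+1 then fun x y => tlift (fun v x' => tens v (tmul x' y)) x
  else fun (c : K) y => c *: y.

Lemma tmul_bilin m n :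
  (forall y : tpow n, linear (fun x : tpow m => tmul x y)) /\
  (forall x : tpow m, linear (@tmul m n x)).
Proof.
elim: m => [|m [IHl IHr]].
  split=> [y a c d|c a y z] /=; first by rewrite scalerDl -scalerA.
  by rewrite scalerDr !scalerA mulrC.
have bl (y : tpow n) (x' : tpow m) : linear (fun v : V => tens v (tmul x' y)).
  exact: tens_linearl.
have br (y : tpow n) (v : V) : linear (fun x' : tpow m => tens v (tmul x' y)).
  by move=> a p q; rewrite IHl tens_linearr.
split=> [y|x a y z]; first exact: tlift_linear.
elim/(@tensor_ind K): x => [|p q /= Hp Hq|v x'].
- by rewrite /= !(linear0E (tlift_linear (bl _) (br _))) scaler0 addr0.
- rewrite /= !(linearDE (tlift_linear (bl _) (br _))) Hp Hq.
  by rewrite scalerDr addrACA.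
- by rewrite /= !tlift_tens // IHr tens_linearr.
Qed.

Lemma tmul_linearl m n (y : tpow n) : linear (fun x : tpow m => tmul x y).
Proof. exact: (tmul_bilin m n).1. Qed.
Lemma tmul_linearr m n (x : tpow m) : linear (@tmul m n x).
Proof. exact: (tmul_bilin m n).2. Qed.

Lemma tmul_tens m n v (x : tpow m) (y : tpow n) :
  tmul (tens v x : tpow m.+1) y = tens v (tmul x y).
Proof.
rewrite /= tlift_tens // => [w|u]; first exact: tens_linearl.
by move=> a p q; rewrite tmul_linearl tens_linearr.
Qed.

Lemma tpow1_bilin :
  (forall c : K, linear (fun v : V => c *: v)) /\
  (forall v : V, linear (fun c : K^o => (c : K) *: v)).
Proof.
split=> [c a u v|v a c d]; first by rewrite scalerDr !scalerA mulrC.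
by rewrite scalerDl -scalerA.
Qed.

Lemma tpow1_linear : linear tpow1.
Proof. exact: (@tlift_linear K V (tpow 0) V _ tpow1_bilin.1 tpow1_bilin.2). Qed.

Lemma tpow1_tens v (c : K) : tpow1 (tens v (c : K^o)) = c *: v.
Proof. exact: (@tlift_tens K V (tpow 0) V _ tpow1_bilin.1 tpow1_bilin.2). Qed.

(* The tensor algebra of V, a graded K-algebra. *)
Definition TA : Type := dsum tpow.
HB.instance Definition _ := GRing.Lmodule.on TA.

Definition TAin n (x : tpow n) : TA := dsin x.

Lemma TAin_linear n : linear (@TAin n).
Proof. exact: dsin_is_linear. Qed.

Definition TAmul (a b : TA) : TA :=
  dlift (fun i x => dlift (fun j y => TAin (tmul x y)) (b : dsum tpow))
    (a : dsum tpow).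

Let TAmul_inner_linear i (x : tpow i) : forall j,
  linear (fun y : tpow j => TAin (tmul x y)).
Proof. by move=> j a y z; rewrite tmul_linearr TAin_linear. Qed.

Let TAmul_inner_in i (x : tpow i) j (z : tpow j) :
  dlift (fun j y => TAin (tmul x y)) (dsin z) = TAin (tmul x z).
Proof.
by rewrite dlift_dsin // => k; exact: (linear0E (@TAmul_inner_linear i x k)).
Qed.

Let TAmul_outer_linear (b : TA) : forall i, linear (fun x : tpow i =>
  dlift (fun j y => TAin (tmul x y)) (b : dsum tpow)).
Proof.
move=> i a x y; elim/(@dsum_ind K): b => [|b c Hb Hc|j z].
- by rewrite !(linear0E (dlift_linear (TAmul_inner_linear _))) scaler0 addr0.
- rewrite !(linearDE (dlift_linear (TAmul_inner_linear _))) Hb Hc.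
  by rewrite scalerDr addrACA.
- by rewrite !TAmul_inner_in tmul_linearl TAin_linear.
Qed.

Lemma TAmul_linearl b : linear (TAmul^~ b).
Proof. exact: dlift_linear. Qed.

Lemma TAmul_in i j (x : tpow i) (y : tpow j) :
  TAmul (TAin x) (TAin y) = TAin (tmul x y).
Proof.
rewrite /TAmul {1}/TAin dlift_dsin ?TAmul_inner_in // => k.
exact: (linear0E (@TAmul_outer_linear _ k)).
Qed.

Lemma TA_ind (P : TA -> Prop) :
  P 0 -> (forall x y, P x -> P y -> P (x + y)) ->
  (forall n v, P (@TAin n v)) -> forall x, P x.
Proof. exact: (@dsum_ind K). Qed.

Lemma TAmul_linearr a : linear (TAmul a).
Proof.
elim/TA_ind: a => [|p q Hp Hq|i x] c b d.
- by rewrite !(linear0E (TAmul_linearl _)) scaler0 addr0.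
- by rewrite !(linearDE (TAmul_linearl _)) Hp Hq scalerDr addrACA.
- have E z : TAmul (TAin x) z = dlift (fun j y => TAin (tmul x y)) z.
    rewrite /TAmul {1}/TAin dlift_dsin // => k.
    exact: (linear0E (@TAmul_outer_linear _ k)).
  by rewrite !E dlift_linear.
Qed.

Let cons_left v : TA -> TA :=
  fun x => dlift (fun n y => TAin (tens v y : tpow n.+1)) (x : dsum tpow).

Let cons_left_in v n (y : tpow n) :
  cons_left v (TAin y) = TAin (tens v y : tpow n.+1).
Proof.
have cl k : linear (fun x : tpow k => TAin (tens v x : tpow k.+1)).
  by move=> a p q; rewrite tens_linearr (TAin_linear a).
rewrite /cons_left {1}/TAin dlift_dsin // => k; exact: (linear0E (cl k)).
Qed.

Lemma tmulA m n p (x : tpow m) (y : tpow n) (z : tpow p) :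
  TAin (tmul (tmul x y) z) = TAin (tmul x (tmul y z)).
Proof.
elim: m x => [|m IH] x.
  by rewrite /= (linearZE (tmul_linearl z)).
elim/(@tensor_ind K): x => [|a b Ha Hb|v x].
- have l0 (k l : nat) (w : tpow l) : tmul (0 : tpow k) w = 0.
    by rewrite (linear0E (tmul_linearl _)).
  by rewrite (l0 m.+1 n y) (l0 (m.+1 + n)%N p z) (l0 m.+1) !(linear0E (@TAin_linear _)).
- have lD (k l : nat) (w : tpow l) (c d : tpow k) :
    tmul (c + d) w = tmul c w + tmul d w.
    by rewrite (linearDE (tmul_linearl _)).
  rewrite (lD m.+1) (lD (m.+1 + n)%N) (lD m.+1).
  by rewrite !(linearDE (@TAin_linear _)) Ha Hb.
- rewrite (tmul_tens v x y) (tmul_tens v (tmul x y) z) tmul_tens.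
  by rewrite -[LHS](cons_left_in v) IH [LHS](cons_left_in v).
Qed.

Lemma tmulx1 n (x : tpow n) : TAin (@tmul n 0 x (1 : K)) = TAin x.
Proof.
elim: n x => [|n IH] x; first by rewrite /= /GRing.scale /= mulr1.
elim/(@tensor_ind K): x => [|a b Ha Hb|v x].
- by rewrite (linear0E (tmul_linearl _)) !(linear0E (@TAin_linear _)).
- by rewrite (linearDE (tmul_linearl _)) !(linearDE (@TAin_linear _)) Ha Hb.
- by rewrite tmul_tens -[LHS](cons_left_in v) IH cons_left_in.
Qed.

Definition TAone : TA := TAin (n := 0) (1 : K).

Fact TAmulA : associative TAmul.
Proof.
move=> a b c; elim/TA_ind: a => [|p q Hp Hq|i x].
- by rewrite !(linear0E (TAmul_linearl _)).
- by rewrite !(linearDE (TAmul_linearl _)) Hp Hq.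
elim/TA_ind: b => [|p q Hp Hq|j y].
- by rewrite (linear0E (TAmul_linearr _)) !(linear0E (TAmul_linearl _))
    (linear0E (TAmul_linearr _)).
- rewrite (linearDE (TAmul_linearr _)) !(linearDE (TAmul_linearl _)).
  by rewrite (linearDE (TAmul_linearr _)) Hp Hq.
elim/TA_ind: c => [|p q Hp Hq|k z].
- by rewrite !(linear0E (TAmul_linearr _)).
- by rewrite !(linearDE (TAmul_linearr _)) Hp Hq.
by rewrite !TAmul_in tmulA.
Qed.

Fact TAmul1x : left_id TAone TAmul.
Proof.
move=> a; elim/TA_ind: a => [|p q Hp Hq|i x].
- by rewrite !(linear0E (TAmul_linearr _)).
- by rewrite !(linearDE (TAmul_linearr _)) Hp Hq.
- by rewrite TAmul_in /= scale1r.
Qed.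

Fact TAmulx1 : right_id TAone TAmul.
Proof.
move=> a; elim/TA_ind: a => [|p q Hp Hq|i x].
- by rewrite !(linear0E (TAmul_linearl _)).
- by rewrite !(linearDE (TAmul_linearl _)) Hp Hq.
- by rewrite TAmul_in tmulx1.
Qed.

Fact TAmulDl : left_distributive TAmul +%R.
Proof. by move=> a b c; rewrite (linearDE (TAmul_linearl _)). Qed.
Fact TAmulDr : right_distributive TAmul +%R.
Proof. by move=> a b c; rewrite (linearDE (TAmul_linearr _)). Qed.
Fact TAone_neq0 : TAone != 0.
Proof.
apply/eqP => /(congr1 (fun x : dsum tpow => (x 0 : K))).
by rewrite dsin_in; apply/eqP; exact: oner_neq0.
Qed.

HB.instance Definition _ := GRing.Zmodule_isNzRing.Build TA
  TAmulA TAmul1x TAmulx1 TAmulDl TAmulDr TAone_neq0.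

Fact TA_scaleAl (a : K) (x y : TA) : a *: (x * y) = (a *: x) * y.
Proof. by rewrite -(linearZE (TAmul_linearl y)). Qed.
Fact TA_scaleAr (a : K) (x y : TA) : a *: (x * y) = x * (a *: y).
Proof. by rewrite -(linearZE (TAmul_linearr x)). Qed.
HB.instance Definition _ := GRing.Lmodule_isLalgebra.Build K TA TA_scaleAl.
HB.instance Definition _ := GRing.Lalgebra_isAlgebra.Build K TA TA_scaleAr.

Lemma TAin_mul i j (x : tpow i) (y : tpow j) :
  TAin x * TAin y = TAin (tmul x y).
Proof. exact: TAmul_in. Qed.

Definition TAcomp n (x : TA) : tpow n := (x : dsum tpow) n.

Definition TAhomog n (x : TA) : Prop := exists y : tpow n, x = TAin y.

End TensorPowers.

Inductive gtree : Type := gleaf | gnode of gtree & gtree.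

HB.instance Definition _ := gen_eqMixin gtree.
HB.instance Definition _ := gen_choiceMixin gtree.

Fixpoint leaf (t : gtree) : nat :=
  if t is gnode u v then (leaf u + leaf v)%N else 1%N.

Section TreeTensor.
Context {K : fieldType}.

(* The tree-tensor algebra of W. *)
Definition That (W : lmodType K) : lmodType K :=
  dsum (fun t : gtree => tpow W (leaf t)).

(* The tree-tensor algebra of K, identified with the free module on the grading
   trees. *)
Definition ThatK : lmodType K := dsum (fun _ : gtree => K^o).

End TreeTensor.

(* Generating trees with labels in W: a node built with n has 2(n+1) children,
   so arity (defined below) is half the number of children and is positive. *)
CoInductive gentree (W : Type) : Type :=
  GenNode (lab : W) (n : nat) (l r : 'I_n.+1 -> gentree W).

Inductive side := Lft | Rgt.
(* The symbols L(i), R(i) with i >= 1 are encoded as (Lft, i - 1), (Rgt, i - 1). *)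
Definition position : Type := seq (side * nat).

Section GenTree.
Context {W : Type}.
Implicit Types (s : gentree W) (r : position) (t u v : gtree).

Definition rlabel s : W := let: GenNode x _ _ _ := s in x.
Definition arity s : nat := let: GenNode _ n _ _ := s in n.+1.
Definition lchild s : 'I_(arity s) -> gentree W :=
  let: GenNode _ _ l _ := s in l.
Definition rchild s : 'I_(arity s) -> gentree W :=
  let: GenNode _ _ _ r := s in r.
Definition child s (d : side) : 'I_(arity s) -> gentree W :=
  if d is Lft then lchild (s := s) else rchild (s := s).

Fixpoint subtree s r : option (gentree W) :=
  if r is (d, i) :: r' then
    if insub i is Some j then subtree (@child s d j) r' else None
  else Some s.

Definition label_at (w0 : W) s r : W :=
  if subtree s r is Some s' then rlabel s' else w0.

End GenTree.

(* An assignment attaches to each inner node q of t a natural number, which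
   stands for iota<q> - 1. *)
Fixpoint assign (t : gtree) : choiceType :=
  if t is gnode u v then (nat * assign u * assign v)%type else unit.

(* The position sequences r_1, ..., r_n attached to the leaves of t. *)
Fixpoint leafpos (t : gtree) : assign t -> (leaf t).-tuple position :=
  match t with
  | gleaf => fun=> [tuple [::]]
  | gnode u v => fun '(i, a, b) =>
    [tuple of [seq (Lft, i) :: p | p <- leafpos a] ++
              [seq (Rgt, i) :: p | p <- leafpos b]]
  end.

Definition valid (W : Type) (s : gentree W) (t : gtree) : set (assign t) :=
  [set a | all (fun p => isSome (subtree s p)) (leafpos a)].
Arguments valid {W} s t.

(* The sum over iota of F (s<r_1>, ..., s<r_n>); valid s t is finite, see
   mem_enum_assign. *)
Definition tree_sum (W M : nmodType) (s : gentree W) (t : gtree)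
    (F : (leaf t).-tuple W -> M) : M :=
  \sum_(a \in valid s t) F [tuple of [seq label_at 0 s p | p <- leafpos a]].

Section TreeSumTheory.
Context {W : nmodType}.
Implicit Types (s : gentree W) (t u v : gtree).

Fixpoint enum_assign s t : seq (assign t) :=
  match t with
  | gleaf => [:: tt]
  | gnode u v =>
    [seq (val j, ab.1, ab.2) | j <- enum 'I_(arity s),
      ab <- [seq (a, b) | a <- enum_assign (lchild j) u,
                          b <- enum_assign (rchild j) v]]
  end.

Lemma leaf_gt0 t : (0 < leaf t)%N.
Proof. by elim: t => //= u Hu v _; rewrite addn_gt0 Hu. Qed.

Lemma valid_node s u v i (a : assign u) (b : assign v) :
  valid s (gnode u v) (i, a, b) <->
  exists2 j : 'I_(arity s), i = j & valid (lchild j) u a /\ valid (rchild j) v b.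
Proof.
rewrite /valid /= all_cat !all_map /=; split=> [|[j -> []]]; last first.
  move=> Ha Hb; apply/andP; split.
    by apply: sub_all Ha => p /=; rewrite valK.
  by apply: sub_all Hb => p /=; rewrite valK.
have a0 : (0 < size (leafpos a))%N by rewrite size_tuple leaf_gt0.
case/andP=> [Ha Hb].
have [j Ej] : exists j : 'I_(arity s), i = j.
  case: (tval (leafpos a)) Ha a0 => //= p l.
  by case: insubP => // j _ <- _ _; exists j.
subst i; exists j => //; split.
  by apply: sub_all Ha => p /=; rewrite valK.
by apply: sub_all Hb => p /=; rewrite valK.
Qed.

Lemma mem_enum_assign s t (a : assign t) : a \in enum_assign s t <-> valid s t a.
Proof.
elim: t s a => [|u IHu v IHv] s a; first by case: a.
case: a => [[i a] b]; rewrite valid_node /=; split.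
  case/allpairsPdep => j [[a' b'] [_ /allpairsPdep[a1 [b1 [Ha Hb [-> ->]]]] /=]].
  by case=> -> -> ->; exists j => //; split; [apply/IHu|apply/IHv].
case=> j -> [/IHu Ha /IHv Hb]; apply/allpairsPdep.
exists j, (a, b); split=> //; first by rewrite mem_enum.
by apply/allpairsPdep; exists a, b.
Qed.

Lemma uniq_enum_assign s t : uniq (enum_assign s t).
Proof.
elim: t s => [|u IHu v IHv] s //=; apply: allpairs_uniq_dep.
- exact: enum_uniq.
- move=> j _; apply: allpairs_uniq; [exact: IHu|exact: IHv|].
  by move=> [? ?] [? ?] _ _ [-> ->].
- by move=> [i [a b]] [j [c d]] _ _ /= [/val_inj -> -> ->].
Qed.

Lemma tree_sumE (M : nmodType) s t (F : (leaf t).-tuple W -> M) :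
  tree_sum s F = \sum_(a <- enum_assign s t)
    F [tuple of [seq label_at 0 s p | p <- leafpos a]].
Proof.
rewrite /tree_sum [RHS]fsbig_seq ?uniq_enum_assign //; apply: eq_fsbigl.
by apply/seteqP; split=> a /mem_enum_assign.
Qed.

Lemma tree_sum_leaf (M : nmodType) s (F : 1.-tuple W -> M) :
  tree_sum (t := gleaf) s F = F [tuple rlabel s].
Proof. by rewrite tree_sumE /= big_seq1; congr F; apply: val_inj. Qed.

Lemma tree_sum_node (M : nmodType) s u v (F : (leaf u + leaf v).-tuple W -> M) :
  tree_sum (t := gnode u v) s F =
  \sum_(j < arity s) tree_sum (lchild j) (fun x : (leaf u).-tuple W =>
    tree_sum (rchild j) (fun y : (leaf v).-tuple W => F [tuple of x ++ y])).
Proof.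
rewrite tree_sumE /= big_allpairs_dep big_enum; apply: eq_bigr => j _ /=.
rewrite big_allpairs_dep tree_sumE; apply: eq_bigr => a _ /=.
rewrite tree_sumE; apply: eq_bigr => b _; congr F; apply: val_inj => /=.
by rewrite map_cat -!map_comp; congr (_ ++ _); apply: eq_map => p /=;
  rewrite /label_at /= valK.
Qed.

Lemma eq_tree_sum (M : nmodType) s t (F G : (leaf t).-tuple W -> M) :
  F =1 G -> tree_sum s F = tree_sum s G.
Proof. by move=> FG; rewrite !tree_sumE; apply: eq_bigr. Qed.

End TreeSumTheory.

Section Generated.
Context {K : fieldType} {W : lmodType K}.
Implicit Types (s : gentree W) (t u v : gtree).

Definition gen s t : tpow W (leaf t) := tree_sum s (@ptens K W (leaf t)).

Fact genhom_subproof s (x : ThatK (K := K)) :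
  (fun t => (x t : K) *: gen s t : tpow W (leaf t)) \in
  @fin_supp K gtree (fun t => tpow W (leaf t)).
Proof.
have /asboolP xf : dcomp x \in fin_supp by case: x.
apply/asboolP; apply: sub_finite_set xf => t /=; apply: contraNneq => ->.
by rewrite scale0r.
Qed.
(* The homomorphism generated by s: the linear extension of t |-> gen s t. *)
Definition genhom s (x : ThatK (K := K)) : That W := DSum (genhom_subproof s x).

Lemma ptens_cat m n (x : m.-tuple W) (y : n.-tuple W) :
  ptens [tuple of x ++ y] = tmul (ptens x) (ptens y).
Proof.
elim: m x => [|m IH] x.
  rewrite tuple0 /= scale1r; congr ptens; exact: val_inj.
case/tupleP: x => a x.
have -> : ptens [tuple of a :: x] = tens a (ptens x).
  by rewrite /= theadE; congr (tens _ (ptens _)); apply: val_inj.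
rewrite tmul_tens -IH /=; congr (tens _ (ptens _)) => //.
by apply: val_inj.
Qed.

Lemma gen_leaf s : gen s gleaf = tens (rlabel s) (1 : K^o).
Proof. by rewrite /gen tree_sum_leaf /= theadE. Qed.

Lemma gen_node s u v : gen s (gnode u v) =
  \sum_(j < arity s) tmul (gen (lchild j) u) (gen (rchild j) v).
Proof.
rewrite /gen tree_sum_node; apply: eq_bigr => j _.
rewrite !tree_sumE (linear_sumE (tmul_linearl _)); apply: eq_bigr => a _.
rewrite tree_sumE (linear_sumE (tmul_linearr _)); apply: eq_bigr => b _.
exact: ptens_cat.
Qed.

Definition gadd s s' : gentree W :=
  let: GenNode x n l r := s in let: GenNode y m l' r' := s' in
  GenNode (x + y) (n := (n + m.+1)%N)
    (fun j : 'I_(n.+1 + m.+1) =>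
       match fintype.split j with inl i => l i | inr i => l' i end)
    (fun j : 'I_(n.+1 + m.+1) =>
       match fintype.split j with inl i => r i | inr i => r' i end).

CoFixpoint gscale (c : K) s : gentree W :=
  let: GenNode x _ l r := s in GenNode (c *: x) (fun i => gscale c (l i)) r.

CoFixpoint gzero : gentree W :=
  GenNode (0 : W) (fun _ : 'I_1 => gzero) (fun _ : 'I_1 => gzero).

Lemma gscaleE c s : gscale c s =
  let: GenNode x _ l r := s in GenNode (c *: x) (fun i => gscale c (l i)) r.
Proof.
rewrite [LHS](_ : _ = let: GenNode x _ l r := gscale c s in GenNode x l r);
  by [case: s|case: (gscale c s)].
Qed.

Lemma gzeroE : gzero = GenNode (0 : W) (fun _ : 'I_1 => gzero) (fun _ => gzero).
Proof.
by rewrite [LHS](_ : _ = let: GenNode x _ l r := gzero in GenNode x l r) //;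
  case: gzero.
Qed.

Lemma gen_add s s' t : gen (gadd s s') t = gen s t + gen s' t.
Proof.
case: s s' t => [x n l r] [y m l' r'] [|u v].
  rewrite !gen_leaf /=; exact: linearDE (tens_linearl _) _ _.
rewrite !gen_node /= [LHS](@big_split_ord _ _ _ n.+1 m.+1) /=.
congr (_ + _); apply: eq_bigr => i _.
  by rewrite !(unsplitK (inl i)).
by rewrite !(unsplitK (inr i)).
Qed.

Lemma gen_scale c s t : gen (gscale c s) t = c *: gen s t.
Proof.
elim: t s => [|u IHu v IHv] [x n l r]; rewrite gscaleE.
  rewrite !gen_leaf /=; exact: linearZE (tens_linearl _) _ _.
rewrite !gen_node /= scaler_sumr; apply: eq_bigr => i _.
by rewrite IHu (linearZE (tmul_linearl _)).
Qed.

Lemma gen_zero t : gen gzero t = 0.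
Proof.
elim: t => [|u IHu v IHv]; rewrite gzeroE.
  rewrite !gen_leaf /=; exact: linear0E (tens_linearl _).
rewrite !gen_node /= big1 // => i _.
by rewrite IHu (linear0E (tmul_linearl _)).
Qed.

End Generated.

Section Normal.
Context {K : fieldType} (V : lmodType K).

(* The labels: V (+) K. *)
Definition lbl : lmodType K := (V * K^o)%type.

Implicit Types (s : gentree lbl) (t u v : gtree).

(* The projections of V (+) K, with V and K embedded in the tensor algebra in
   degrees 1 and 0; true stands for the projection to V. *)
Definition TAproj (b : bool) (x : lbl) : TA V :=
  if b then TAin (tens x.1 1 : tpow V 1) else TAin (n := 0) (x.2 : tpow V 0).

Definition ptuple t : Type := (leaf t).-tuple bool.
Definition pdeg t (a : ptuple t) : nat := count id a.

(* s<t | alpha>. Multiplying in the tensor algebra performs the identification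
   of a tensor product of pdeg alpha copies of V and some copies of K with the
   tensor power of V of exponent pdeg alpha (gval_homog). *)
Definition gval s t (a : ptuple t) : TA V :=
  tree_sum s (fun x : (leaf t).-tuple lbl =>
    \prod_(k < leaf t) TAproj (tnth a k) (tnth x k)).

Definition weakly_normal s : Prop :=
  forall t u (a : ptuple t) (b : ptuple u), pdeg a = pdeg b ->
  gval s a = gval s b.

Definition normal s : Prop :=
  forall p s', subtree s p = Some s' -> weakly_normal s'.

Lemma TAproj_linear b : linear (TAproj b).
Proof.
move=> c x y; case: b; rewrite /TAproj /=.
  by rewrite tens_linearl TAin_linear.
by rewrite -TAin_linear.
Qed.

Lemma gval_leaf s (a : ptuple gleaf) : gval s a = TAproj (thead a) (rlabel s).
Proof. by rewrite /gval tree_sum_leaf big_ord1. Qed.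

Definition lptuple u v (a : ptuple (gnode u v)) : ptuple u :=
  [tuple tnth a (lshift (leaf v) i) | i < leaf u].
Definition rptuple u v (a : ptuple (gnode u v)) : ptuple v :=
  [tuple tnth a (rshift (leaf u) i) | i < leaf v].

Lemma gval_node s u v (a : ptuple (gnode u v)) :
  gval s a = \sum_(j < arity s)
    gval (lchild j) (lptuple a) * gval (rchild j) (rptuple a).
Proof.
rewrite /gval tree_sum_node; apply: eq_bigr => j _.
rewrite !tree_sumE mulr_suml; apply: eq_bigr => c _.
rewrite tree_sumE mulr_sumr; apply: eq_bigr => d _.
rewrite big_split_ord; apply: (congr2 (fun x y : TA V => x * y)).
all: apply: eq_bigr => i _.
  by rewrite tnth_lshift tnth_mktuple.
by rewrite tnth_rshift tnth_mktuple.
Qed.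

Lemma pdeg_node u v (a : ptuple (gnode u v)) :
  pdeg a = (pdeg (lptuple a) + pdeg (rptuple a))%N.
Proof.
have E n (x : n.-tuple bool) : count id x = (\sum_(k < n) tnth x k)%N.
  by rewrite -sum1_count big_mkcond big_tuple; apply: eq_bigr => k _; case: (tnth x k).
rewrite /pdeg !E big_split_ord; congr (_ + _)%N; apply: eq_bigr => i _.
  by rewrite tnth_mktuple.
by rewrite tnth_mktuple.
Qed.

Lemma gval_add s s' t (a : ptuple t) :
  gval (gadd s s') a = gval s a + gval s' a.
Proof.
case: s s' t a => [x n l r] [y m l' r'] [|u v] a.
  rewrite !gval_leaf /=; exact: linearDE (TAproj_linear _) _ _.
rewrite !gval_node /= [LHS](@big_split_ord _ _ _ n.+1 m.+1) /=.
congr (_ + _); apply: eq_bigr => i _.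
  by rewrite !(unsplitK (inl i)).
by rewrite !(unsplitK (inr i)).
Qed.

Lemma gval_scale c s t (a : ptuple t) : gval (gscale c s) a = c *: gval s a.
Proof.
elim: t s a => [|u IHu v IHv] [x n l r] a; rewrite gscaleE.
  rewrite !gval_leaf /=; exact: linearZE (TAproj_linear _) _ _.
rewrite !gval_node /= scaler_sumr; apply: eq_bigr => i _.
by rewrite IHu scalerAl.
Qed.

Lemma gval_zero t (a : ptuple t) : gval gzero a = 0.
Proof.
elim: t a => [|u IHu v IHv] a; rewrite gzeroE.
  rewrite !gval_leaf /=; exact: linear0E (TAproj_linear _).
by rewrite !gval_node /= big1 // => i _; rewrite IHu mul0r.
Qed.

Lemma normal_weak s : normal s -> weakly_normal s.
Proof. by move=> /(_ [::] s erefl). Qed.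

Lemma normal_child s d (j : 'I_(arity s)) : normal s -> normal (child d j).
Proof.
by move=> ns p s' sp; apply: (ns ((d, val j) :: p)); rewrite /= valK.
Qed.

Lemma normalI s : weakly_normal s ->
  (forall d (j : 'I_(arity s)), normal (child d j)) -> normal s.
Proof.
move=> ws cs [|[d i] p] s' /=; first by case=> <-.
by case: insubP => //= j _ _; apply: cs.
Qed.

Lemma normal_zero : normal gzero.
Proof.
have child0 s : s = GenNode 0 (fun _ : 'I_1 => gzero) (fun _ => gzero) ->
    forall d j, child (s := s) d j = gzero by move=> -> [].
move=> p s' ps; suff -> : s' = gzero by move=> t u a b _; rewrite !gval_zero.
elim: p ps => [|[d i] p IH] /=; first by case.
by case: insubP => // j _ _; rewrite child0 //; exact: gzeroE.
Qed.

Lemma normal_scale c s : normal s -> normal (gscale c s).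
Proof.
move=> ns p s'; elim: p s ns => [|[d i] p IH] s ns.
  by case=> <- t u a b ab; rewrite !gval_scale (normal_weak ns ab).
have nc j := @normal_child s d j ns; case: s ns nc => x n l r ns nc.
rewrite gscaleE /=; case: insubP => // j _ _.
case: d nc => nc /=; first exact/IH/(nc j).
exact: nc.
Qed.

Lemma normal_add s s' : normal s -> normal s' -> normal (gadd s s').
Proof.
move=> ns ns'; apply: normalI.
  move=> t u a b ab; rewrite !gval_add.
  by rewrite (normal_weak ns ab) (normal_weak ns' ab).
have nc d j := @normal_child s d j ns.
have nc' d j := @normal_child s' d j ns'.
case: s s' {ns ns'} nc nc' => [x n l r] [y m l' r'] nc nc' d j.
case: d => /=; case: (fintype.split (j : 'I_(n.+1 + m.+1))) => i.
- exact: (nc Lft).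
- exact: (nc' Lft).
- exact: (nc Rgt).
- exact: (nc' Rgt).
Qed.

Lemma TAhomog_sum n J (r : seq J) (P : pred J) (F : J -> TA V) :
  (forall j, TAhomog n (F j)) -> TAhomog n (\sum_(j <- r | P j) F j).
Proof.
move=> HF; elim/big_ind: _ => [|x y [x' ->] [y' ->]|//].
  by exists 0; rewrite (linear0E (@TAin_linear _ _ _)).
by exists (x' + y'); rewrite (linearDE (@TAin_linear _ _ _)).
Qed.

Lemma TAhomogM m n (x y : TA V) :
  TAhomog m x -> TAhomog n y -> TAhomog (m + n) (x * y).
Proof. by case=> x' -> [y' ->]; exists (tmul x' y'); rewrite TAin_mul. Qed.

Lemma gval_homog s t (a : ptuple t) : TAhomog (pdeg a) (gval s a).
Proof.
elim: t s a => [|u IHu v IHv] s a.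
  rewrite gval_leaf /TAproj /pdeg; case/(@tupleP 0 bool): a => b a.
  by rewrite theadE tuple0; case: b; eexists.
rewrite gval_node pdeg_node; apply: TAhomog_sum => j.
exact: TAhomogM.
Qed.

Lemma pdeg_surj n : exists t (a : ptuple t), pdeg a = n.
Proof.
elim: n => [|n [t [a an]]]; first by exists gleaf, [tuple false].
by exists (gnode gleaf t), [tuple of true :: a]; rewrite /pdeg /= -[count _ _]/(pdeg a) an.
Qed.

(* For normal s, the common value s<n> (nvalP). *)
Definition nval s n : tpow V n :=
  xget 0 [set x | forall t (a : ptuple t), pdeg a = n -> gval s a = TAin x].

Lemma nvalP s t (a : ptuple t) :
  normal s -> gval s a = TAin (nval s (pdeg a)).
Proof.
move=> ns; rewrite /nval; case: xgetP => [x _ /(_ t a erefl) //|none].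
have [x ax] := gval_homog s a.
by case: (none x) => u b ba; rewrite -ax; exact: normal_weak.
Qed.

Definition Nor_pred : {pred ThatK (K := K) -> That lbl} :=
  fun f => `[< exists2 s : gentree lbl, normal s & f = genhom s >].

Fact Nor_closed : submod_closed Nor_pred.
Proof.
split=> [|c f g /asboolP[s ns ->] /asboolP[s' ns' ->]]; apply/asboolP.
  exists gzero; first exact: normal_zero.
  by apply/funext => x; apply: dsumP => t /=; rewrite gen_zero scaler0.
exists (gadd (gscale c s) s'); first exact/normal_add/ns'/normal_scale.
apply/funext => x; apply: dsumP => t.
rewrite -[LHS]/(c *: (x t *: gen s t) + x t *: gen s' t).
rewrite -[RHS]/((x t : K) *: gen (gadd (gscale c s) s') t).
by rewrite gen_add gen_scale scalerDr !scalerA mulrC.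
Qed.
HB.instance Definition _ :=
  GRing.isSubmodClosed.Build K (ThatK (K := K) -> That lbl) Nor_pred Nor_closed.

Record Nor : Type :=
  MkNor { Nor_fun :> ThatK (K := K) -> That lbl; _ : Nor_fun \in Nor_pred }.

HB.instance Definition _ := [isSub for Nor_fun].
HB.instance Definition _ := [Choice of Nor by <:].
HB.instance Definition _ := [SubChoice_isSubLmodule of Nor by <:].

End Normal.

Section Coalgebra.
Context {K : fieldType}.

Definition tmap (A B A' B' : lmodType K) (f : A -> A') (g : B -> B') :
    tensor A B -> tensor A' B' :=
  tlift (fun a b => tens (f a) (g b)).

Definition tassoc (A B C : lmodType K) :
    tensor (tensor A B) C -> tensor A (tensor B C) :=
  tlift (fun ab c => tlift (fun a b => tens a (tens b c)) ab).

Record is_coalgebra (C : lmodType K) (delta : C -> tensor C C) (eps : C -> K) :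
    Prop := IsCoalgebra {
  comul_linear : linear delta;
  counit_linear : scalar eps;
  comul_coassoc : forall c,
    tassoc (tmap delta id (delta c)) = tmap id delta (delta c);
  comul_counitl : forall c, tlift (fun a b => eps a *: b) (delta c) = c;
  comul_counitr : forall c, tlift (fun a b => eps b *: a) (delta c) = c
}.

Record coalgebra_iso (C D : lmodType K)
    (deltaC : C -> tensor C C) (epsC : C -> K)
    (deltaD : D -> tensor D D) (epsD : D -> K) (phi : C -> D) : Prop :=
  CoalgebraIso {
  iso_source : is_coalgebra deltaC epsC;
  iso_target : is_coalgebra deltaD epsD;
  iso_linear : linear phi;
  iso_bijective : bijective phi;
  iso_comul : forall c, deltaD (phi c) = tmap phi phi (deltaC c);
  iso_counit : forall c, epsD (phi c) = epsC c
}.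

End Coalgebra.

Section NorStructure.
Context {K : fieldType} {V : lmodType K}.
Implicit Types (f : Nor V) (s : gentree (lbl V)).

Definition generates s f : Prop := Nor_fun f = genhom s.

(* For normal s, the element of Nor V generated by s (Nor_ofP). *)
Definition Nor_of s : Nor V := insubd 0 (genhom s).

Lemma Nor_ofP s : normal s -> generates s (Nor_of s).
Proof.
move=> ns; rewrite /generates /Nor_of -[Nor_fun _]/(val _) insubdK //.
by apply/asboolP; exists s.
Qed.

Definition delta_family s : tensor (Nor V) (Nor V) :=
  \sum_(i < arity s) tens (Nor_of (lchild i)) (Nor_of (rchild i)).

(* The common value of delta_family s over all normal s generating f. *)
Definition delta f : tensor (Nor V) (Nor V) :=
  xget 0 [set z | forall s, normal s -> generates s f -> z = delta_family s].

Definition at_leaf f : lbl V :=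
  tpow1 (f (dsin (E := fun _ => K^o) (i := gleaf) 1) gleaf).

Definition eps f : K := (at_leaf f).2.
Definition piV f : V := (at_leaf f).1.

End NorStructure.

Section BlockLeroux.
Context {K : fieldType} (V : lmodType K).

(* Degree-preserving linear maps. *)
Definition graded_map (f : {poly K} -> TA V) : Prop :=
  linear f /\ forall n (c : K), TAhomog n (f (c *: 'X^n)).

Definition representative (f : {poly K} -> TA V) : Prop :=
  graded_map f /\ exists n (g h : 'I_n -> {poly K} -> TA V),
    [/\ forall i, graded_map (g i), forall i, graded_map (h i) &
        forall t u, f (t * u) = \sum_(i < n) g i t * h i u].

Definition RepBL_pred : {pred {poly K} -> TA V} := fun f => `[< representative f >].

Lemma graded_map_closed (c : K) (f g : {poly K} -> TA V) :
  graded_map f -> graded_map g -> graded_map (c *: f + g).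
Proof.
move=> [fl fh] [gl gh]; split=> [a x y|n a].
  rewrite -[LHS]/(c *: f (a *: x + y) + g (a *: x + y)).
  rewrite -[RHS]/(a *: (c *: f x + g x) + (c *: f y + g y)).
  by rewrite fl gl !scalerDr !scalerA mulrC addrACA.
rewrite -[_ (_ *: _)]/(c *: f (a *: 'X^n) + g (a *: 'X^n)).
case: (fh n a) => x ->; case: (gh n a) => y ->; exists (c *: x + y).
by rewrite TAin_linear.
Qed.

Lemma graded_map0 : graded_map (0 : {poly K} -> TA V).
Proof.
split=> [a x y|n c]; first by rewrite -[RHS]/(a *: 0 + 0) scaler0 addr0.
by exists 0; rewrite (linear0E (@TAin_linear _ _ _)).
Qed.

Fact RepBL_closed : submod_closed RepBL_pred.
Proof.
split=> [|c f f' /asboolP[Gf [n [g [h [Gg Gh E]]]]]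
               /asboolP[Gf' [n' [g' [h' [Gg' Gh' E']]]]]]; apply/asboolP.
  split; first exact: graded_map0.
  exists 0%N, (fun=> 0), (fun=> 0); split=> [i|i|t u]; rewrite ?big_ord0 //;
    exact: graded_map0.
split; first exact: graded_map_closed.
exists (n + n')%N,
  (fun i => match fintype.split i with inl j => c *: g j | inr j => g' j end),
  (fun i => match fintype.split i with inl j => h j | inr j => h' j end).
split=> [i|i|t u].
- case: (fintype.split i) => j //.
  rewrite -[_ *: _]addr0; apply: graded_map_closed; [exact: Gg|exact: graded_map0].
- by case: (fintype.split i).
rewrite -[LHS]/(c *: f (t * u) + f' (t * u)) big_split_ord E E' scaler_sumr.
apply: (congr2 (fun x y : TA V => x + y)); apply: eq_bigr => i _.
  by rewrite (unsplitK (inl i)) scalerAl.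
by rewrite (unsplitK (inr i)).
Qed.
HB.instance Definition _ :=
  GRing.isSubmodClosed.Build K ({poly K} -> TA V) RepBL_pred RepBL_closed.

Record RepBL : Type :=
  MkRepBL { RepBL_fun :> {poly K} -> TA V; _ : RepBL_fun \in RepBL_pred }.

HB.instance Definition _ := [isSub for RepBL_fun].
HB.instance Definition _ := [Choice of RepBL by <:].
HB.instance Definition _ := [SubChoice_isSubLmodule of RepBL by <:].

End BlockLeroux.

Section BLStructure.
Context {K : fieldType} {V : lmodType K}.
Implicit Types f : RepBL V.

Definition BL_family f n (g h : 'I_n -> RepBL V) : Prop :=
  forall t u : {poly K}, f (t * u) = \sum_(i < n) g i t * h i u.

(* The common value of the sums of g_i (x) h_i over all families of
   representative maps witnessing that f is representative. *)
Definition deltaBL f : tensor (RepBL V) (RepBL V) :=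
  xget 0 [set z |
    (exists n (g h : 'I_n -> RepBL V), BL_family f g h) /\
    forall n (g h : 'I_n -> RepBL V), BL_family f g h ->
      z = \sum_(i < n) tens (g i) (h i)].

(* The elements f(1) and f(X), read in K and V. *)
Definition epsBL f : K := TAcomp 0 (f 1).
Definition piBL f : V := tpow1 (TAcomp 1 (f 'X)).

End BLStructure.

(* Main.v *)
Require Import Defs.
From mathcomp Require Import all_boot all_order all_algebra.
From mathcomp Require Import boolp classical_sets functions.

Set Implicit Arguments.
Unset Strict Implicit.
Unset Printing Implicit Defensive.

Import GRing.Theory.
Local Open Scope classical_set_scope.
Local Open Scope ring_scope.

(** A normal tree [s] is determined, as far as the homomorphism it generates is
    concerned, by its values [nval s n], and its root splits them: evaluating [s]
    on a grading tree with left and right subtrees carrying degrees [m] and [n]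
    gives [nval s (m + n) = \sum_j nval (lchild j) m * nval (rchild j) n]
    ([nval_add]). So [X^n |-> nval s n] is representative, with the corresponding
    maps of the children as factors ([values_mul]), and its comultiplication is
    the image of the family of children ([deltaBL_toBL]).

    The values are linear images of the tensors [gen s t], which gives
    independence of the tree. Conversely a tensor power of [V (+) K] is the direct
    sum of tensor powers of [V] indexed by projection tuples, so the values
    determine every [gen s t] ([nval_gen]): the map is injective.

    For surjectivity, label a node by [(f X, f 1)] for a representative [f], choose
    representative factors [g_i, h_i] of [f], and repeat this at the children
    ([tree_of]). By induction on the grading tree, every formal value of degree [n]
    of this tree is [f X^n] ([gval_tree_of]), so the tree is normal and is sent to
    [f].

    What remains is linear algebra. That the factors can be chosen representative,
    and that [deltaBL] does not depend on them, both come from [tens_reduce]: if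
    all contractions of a tensor by a separating set of linear forms lie in a
    subspace, then the right entries of the tensor can be taken there. The forms
    used on graded maps are iterated contractions ([coordinate]); applied to the
    left factors of a product formula for [f] they give again contractions of [f],
    which are representative. Left factors are treated by reversing tensors.
    Finally a tensor of representative maps is determined by its evaluations at
    polynomials, so the coalgebra axioms for [deltaBL] reduce to associativity
    of the product and unit laws, and they are transported to [delta] along the
    bijection. *)

(** * Linear forms and the reduction of tensors *)

Section Functionals.
Context {K : fieldType} (U : lmodType K).

Let subspace (H : set U) : Prop :=
  forall a x y, H x -> H y -> H (a *: x + y).

(** Zorn's lemma gives a subspace maximal among those avoiding [x0]. If [u] lies
    outside it, then adding [u] makes [x0] reachable, which expresses [u] through
    [x0] modulo the subspace. *)
Lemma maximal_avoiding_subspace (x0 : U) : x0 != 0 ->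
  exists H : set U, [/\ subspace H, H 0, ~ H x0 &
    forall u, exists c, H (u - c *: x0)].
Proof.
move=> x0_neq0.
have [|H [[Hlin Hx0] Hmax]] :=
    @Zorn_bigcup U [set H | subspace H /\ ~ H x0].
  move=> F FP Ftot; split=> [a x y [X FX Xx] [Y FY Yy]|[X FX]]; last first.
    exact: (FP X FX).2.
  have [XY|YX] := Ftot X Y FX FY.
    by exists Y => //; apply: (FP Y FY).1 => //; exact: XY.
  by exists X => //; apply: (FP X FX).1 => //; exact: YX.
(* If [H] were empty, the zero subspace would be larger. *)
have H0 : H 0.
  apply: contrapT => nH0; apply: (Hmax [set 0]).
    split=> [x Hx|/(_ 0 erefl)//].
    by case: nH0; have := Hlin (-1) x x Hx Hx; rewrite scaleN1r addNr.
  split=> [a x y -> ->|/= x00]; first by rewrite scaler0 addr0.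
  by rewrite x00 eqxx in x0_neq0.
have HZ a x : H x -> H (a *: x).
  by move=> Hx; rewrite -[_ *: _]addr0; apply: Hlin.
exists H; split=> // u.
have [Hu|nHu] := pselect (H u); first by exists 0; rewrite scale0r subr0.
pose B : set U := [set z | exists c, H (z - c *: u)].
have : ~ (subspace B /\ ~ B x0).
  apply: Hmax; split=> [z Hz|BH]; first by exists 0; rewrite scale0r subr0.
  by apply: nHu; apply: BH; exists 1; rewrite scale1r subrr.
move/not_andP => [[]|/contrapT[c Hc]].
  move=> a x y [c Hc] [d Hd]; exists (a * c + d).
  by rewrite scalerDl -scalerA opprD addrACA -scalerBr; apply: Hlin.
have c0 : c != 0.
  by apply/eqP => c0; move: Hc; rewrite c0 scale0r subr0.
exists c^-1; rewrite (_ : u - _ = - c^-1 *: (x0 - c *: u)); first exact: HZ.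
by rewrite scalerBr scalerA mulNr mulVf // !scaleNr scale1r opprK addrC.
Qed.

(** The form is the coordinate along [x0] modulo a hyperplane that avoids [x0]. *)
Lemma ex_form (x0 : U) : x0 != 0 -> exists2 chi : U -> K, scalar chi & chi x0 != 0.
Proof.
move=> x0_neq0; have [H [Hlin H0 Hx0 Hdec]] := maximal_avoiding_subspace x0_neq0.
have HZ a x : H x -> H (a *: x).
  by move=> Hx; rewrite -[_ *: _]addr0; apply: Hlin.
have Huniq u c d : H (u - c *: x0) -> H (u - d *: x0) -> c = d.
  move=> Hc Hd; apply/eqP/negPn/negP => cd; apply: Hx0.
  rewrite -(@scalerK _ _ (c - d) _ x0) ?subr_eq0 //; apply: HZ.
  have := Hlin (-1) _ _ Hc Hd.
  by rewrite scaleN1r opprB addrA subrK -scalerBl.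
have [chi chiP] := choice Hdec.
exists chi => [a u v|].
  apply: (Huniq (a *: u + v)); first exact: chiP.
  by rewrite scalerDl -scalerA opprD addrACA -scalerBr; apply: Hlin.
have -> : chi x0 = 1 by apply: (Huniq x0); rewrite ?scale1r ?subrr.
exact: oner_neq0.
Qed.

End Functionals.

Lemma form_scale_linear {K : fieldType} {U W : lmodType K} (chi : U -> K) (w : W) :
  scalar chi -> linear (fun u => chi u *: w).
Proof. by move=> chil c u v; rewrite chil scalerDl -scalerA. Qed.

Lemma scale_linear {K : fieldType} {W : lmodType K} (c : K) :
  linear (fun w : W => c *: w).
Proof. by move=> d w v; rewrite scalerDr !scalerA mulrC. Qed.

Section Reduction.
Context {K : fieldType} {U W : lmodType K}.

Lemma tens_sum (z : tensor U W) :
  exists l : seq (U * W), z = \sum_(p <- l) tens p.1 p.2.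
Proof.
elim/(@tensor_ind K): z => [|x y [l ->] [l' ->]|u w].
- by exists [::]; rewrite big_nil.
- by exists (l ++ l'); rewrite big_cat.
- by exists [:: (u, w)]; rewrite big_seq1.
Qed.

Lemma tensZl a (u : U) (w : W) : tens (a *: u) w = a *: tens u w.
Proof. exact: (linearZE (tens_linearl w)). Qed.
Lemma tensZr a (u : U) (w : W) : tens u (a *: w) = a *: tens u w.
Proof. exact: (linearZE (tens_linearr u)). Qed.
Lemma tensDl (u u' : U) (w : W) : tens (u + u') w = tens u w + tens u' w.
Proof. exact: (linearDE (tens_linearl w)). Qed.
Lemma tensDr (u : U) (w w' : W) : tens u (w + w') = tens u w + tens u w'.
Proof. exact: (linearDE (tens_linearr u)). Qed.

(** If the contractions of a tensor by a separating set of linear forms on the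
    left factor all lie in a subspace [S] of the right factor, then the tensor
    can be rewritten with right entries in [S]. Gaussian elimination on the
    terms: a form that does not vanish on the first left entry expresses the
    first right entry, modulo [S], through the remaining ones. With [S] zero
    this says that contractions detect tensors. *)
Lemma tens_reduce (P : U -> Prop) (S : W -> Prop) (I : Type) (lam : I -> U -> K) :
  (forall a x y, P x -> P y -> P (a *: x + y)) ->
  S 0 -> (forall a x y, S x -> S y -> S (a *: x + y)) ->
  (forall i, scalar (lam i)) ->
  (forall x, P x -> (forall i, lam i x = 0) -> x = 0) ->
  forall l : seq (U * W), (forall p, p \in l -> P p.1) ->
  (forall i, S (\sum_(p <- l) lam i p.1 *: p.2)) ->
  exists2 l' : seq (U * W), forall p, p \in l' -> P p.1 /\ S p.2 &
    \sum_(p <- l) tens p.1 p.2 = \sum_(p <- l') tens p.1 p.2.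
Proof.
move=> Plin S0 Slin lamlin sep l.
have SZ a x : S x -> S (a *: x).
  by move=> Sx; rewrite -[_ *: _]addr0; apply: Slin.
have lamD i a x y : lam i (a *: x + y) = a * lam i x + lam i y by exact: lamlin.
have [n] := ubnP (size l); elim: n l => // n IH [_ _ _|[u w] l /=].
  by exists [::]; rewrite ?big_nil.
rewrite ltnS => ln Pl Sl.
have Pu : P u by apply: (Pl (u, w)); rewrite inE eqxx.
have {}Pl p : p \in l -> P p.1 by move=> pl; apply: Pl; rewrite inE pl orbT.
have [/(sep u Pu) u0|/existsNP[i /eqP iu]] := pselect (forall i, lam i u = 0).
  have [//|//|i|l' Pl' El'] := IH l.
    have := Sl i; rewrite big_cons /= u0.
    by rewrite (linear0E (lamlin i : @linear_for _ _ K^o _ _)) scale0r add0r.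
  by exists l' => //; rewrite big_cons /= u0 (linear0E (tens_linearl w)) add0r.
(* [w] is [s], which lies in [S], minus a combination of the other right entries;
   substituting it changes the other terms by [e] and leaves [u (x) s]. *)
pose s := (lam i u)^-1 *: \sum_(p <- (u, w) :: l) lam i p.1 *: p.2.
have Ss : S s by exact: SZ.
pose e (p : U * W) := (- (lam i p.1 / lam i u) *: u + p.1, p.2).
have wE : w = s - \sum_(p <- l) (lam i p.1 / lam i u) *: p.2.
  rewrite /s big_cons scalerDr scalerK //= scaler_sumr -addrA -sumrB.
  by rewrite big1 ?addr0 // => p _; rewrite scalerA mulrC subrr.
have [||j|l' Pl' El'] := IH [seq e p | p <- l].
- by rewrite size_map.
- by move=> _ /mapP[p pl ->]; apply: Plin => //; apply: Pl.
- have := Slin (- lam j u) _ _ Ss (Sl j); rewrite big_map big_cons /= [w in lam j u *: w]wE.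
  rewrite scalerBr addrA addrA scaleNr addNr add0r => Sj.
  rewrite (_ : \sum_(_ <- _) _ = - (lam j u *: \sum_(p <- l) (lam i p.1 / lam i u) *: p.2)
    + \sum_(p <- l) lam j p.1 *: p.2) //.
  rewrite scaler_sumr -sumrN -big_split; apply: eq_bigr => p _ /=.
  by rewrite lamD scalerDl mulNr scaleNr scalerA mulrC.
exists ((u, s) :: l') => [p|].
  by rewrite inE => /orP[/eqP ->|/Pl'].
have eE : \sum_(p <- l) tens (e p).1 (e p).2 =
    - tens u (\sum_(p <- l) (lam i p.1 / lam i u) *: p.2) + \sum_(p <- l) tens p.1 p.2.
  rewrite (linear_sumE (tens_linearr u)) -sumrN -big_split; apply: eq_bigr => p _ /=.
  by rewrite tens_linearl scaleNr tensZr.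
rewrite !big_cons /= -El' big_map eE addrA; apply: (congr2 +%R) => //.
by rewrite [in LHS]wE tensDr; congr (_ + _); rewrite -scaleN1r tensZr scaleN1r.
Qed.

Lemma tens_eq0 (I : Type) (lam : I -> U -> K) :
  (forall i, scalar (lam i)) ->
  (forall x, (forall i, lam i x = 0) -> x = 0) ->
  forall z : tensor U W, (forall i, tlift (fun u w => lam i u *: w) z = 0) -> z = 0.
Proof.
move=> lamlin sep z; have [l ->] := tens_sum z => Hl.
have lam_bl i (w : W) := form_scale_linear w (lamlin i).
have lam_br i u := @scale_linear K W (lam i u).
have [//|//|a x y -> ->|//|x _|//|i|l' l'0 ->] :=
    @tens_reduce (fun _ => True) (fun w => w = 0) I lam _ _ _ _ _ l.
- by rewrite scaler0 addr0.
- exact: sep.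
- rewrite -[RHS](Hl i) (linear_sumE (tlift_linear (lam_bl i) (lam_br i))).
  by apply: eq_bigr => p _; rewrite tlift_tens.
rewrite big_seq big1 // => p /l'0[_ ->].
exact: (linear0E (tens_linearr _)).
Qed.

End Reduction.

(** * Functoriality of the tensor product *)

Section TensorMaps.
Context {K : fieldType}.
Implicit Types A B C D : lmodType K.

Lemma tensor_ext A B C (f g : tensor A B -> C) : linear f -> linear g ->
  (forall a b, f (tens a b) = g (tens a b)) -> f =1 g.
Proof.
move=> fl gl fg z; elim/(@tensor_ind K): z => [|x y fx fy|//].
  by rewrite (linear0E fl) (linear0E gl).
by rewrite (linearDE fl) (linearDE gl) fx fy.
Qed.

Lemma comp_linear A B C (f : B -> C) (g : A -> B) :
  linear f -> linear g -> linear (fun x => f (g x)).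
Proof. by move=> fl gl a x y; rewrite gl fl. Qed.

Lemma id_linear A : linear (@id A). Proof. by []. Qed.

Section Tmap.
Context {A B A' B' : lmodType K} (f : A -> A') (g : B -> B').
Hypotheses (fl : linear f) (gl : linear g).

Let tmap_bl b : linear (fun a => tens (f a) (g b)).
Proof. by move=> c x y; rewrite fl tens_linearl. Qed.
Let tmap_br a : linear (fun b => tens (f a) (g b)).
Proof. by move=> c x y; rewrite gl tens_linearr. Qed.

Lemma tmap_linear : linear (tmap f g).
Proof. exact: tlift_linear tmap_bl tmap_br. Qed.
Lemma tmap_tens a b : tmap f g (tens a b) = tens (f a) (g b).
Proof. exact: tlift_tens tmap_bl tmap_br _ _. Qed.
Lemma tmap_sum J (r : seq J) (a : J -> A) (b : J -> B) :
  tmap f g (\sum_(j <- r) tens (a j) (b j)) = \sum_(j <- r) tens (f (a j)) (g (b j)).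
Proof.
by rewrite (linear_sumE tmap_linear); apply: eq_bigr => j _; rewrite tmap_tens.
Qed.
End Tmap.

Lemma tmap_comp A B A' B' A2 B2 (f : A -> A') (g : B -> B') (f' : A' -> A2)
    (g' : B' -> B2) : linear f -> linear g -> linear f' -> linear g' ->
  forall z, tmap f' g' (tmap f g z) =
            tmap (fun x => f' (f x)) (fun x => g' (g x)) z.
Proof.
move=> fl gl fl' gl'.
have cfl := comp_linear fl' fl; have cgl := comp_linear gl' gl.
apply: tensor_ext.
- exact: comp_linear (tmap_linear fl' gl') (tmap_linear fl gl).
- exact: tmap_linear cfl cgl.
- by move=> a b; rewrite !tmap_tens.
Qed.

Lemma tmap_id A B (z : tensor A B) : tmap id id z = z.
Proof.
move: z; apply: tensor_ext; [exact: tmap_linear|exact: id_linear|].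
by move=> a b; rewrite tmap_tens.
Qed.

Lemma eq_tmap A B A' B' (f f' : A -> A') (g g' : B -> B') :
  f =1 f' -> g =1 g' -> tmap f g =1 tmap f' g'.
Proof. by move=> /funext -> /funext ->. Qed.

Section Assoc.
Context {A B C : lmodType K}.

Let assoc1_bl (c : C) (b : B) : linear (fun a : A => tens a (tens b c)).
Proof. exact: tens_linearl. Qed.
Let assoc1_br (c : C) (a : A) : linear (fun b : B => tens a (tens b c)).
Proof. by move=> k x y; rewrite tens_linearl tens_linearr. Qed.
Let assoc_bl (c : C) : linear (tlift (fun (a : A) (b : B) => tens a (tens b c))).
Proof. exact: tlift_linear (assoc1_bl c) (assoc1_br c). Qed.
Let assoc_br (y : tensor A B) :
  linear (fun c : C => tlift (fun a b => tens a (tens b c)) y).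
Proof.
move=> k c d; elim/(@tensor_ind K): y => [|x y Hx Hy|a b].
- by rewrite !(linear0E (assoc_bl _)) scaler0 addr0.
- by rewrite !(linearDE (assoc_bl _)) Hx Hy scalerDr addrACA.
- by rewrite !tlift_tens //; rewrite 2!tens_linearr.
Qed.

Lemma tassoc_linear : linear (@tassoc K A B C).
Proof. exact: tlift_linear assoc_bl assoc_br. Qed.
Lemma tassoc_tens a b c : tassoc (tens (tens a b) c) = tens a (tens b c) :> tensor A (tensor B C).
Proof.
rewrite /tassoc (tlift_tens assoc_bl assoc_br).
exact: tlift_tens (assoc1_bl c) (assoc1_br c) _ _.
Qed.
End Assoc.

Lemma tassoc_tmap A B C A' B' C' (f : A -> A') (g : B -> B') (h : C -> C') :
  linear f -> linear g -> linear h -> forall z,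
  tassoc (tmap (tmap f g) h z) = tmap f (tmap g h) (tassoc z).
Proof.
move=> fl gl hl; have fgl := tmap_linear fl gl; have ghl := tmap_linear gl hl.
have Ll := comp_linear (@tassoc_linear A' B' C') (tmap_linear fgl hl).
have Rl := comp_linear (tmap_linear fl ghl) (@tassoc_linear A B C).
apply: tensor_ext => // y c; move: y; apply: tensor_ext.
- by move=> k x y; rewrite tens_linearl Ll.
- by move=> k x y; rewrite tens_linearl Rl.
by move=> a b; rewrite tassoc_tens !tmap_tens // tassoc_tens.
Qed.

(** Every map in an axiom for [deltaC] and [epsC] is conjugate by [phi] to the
    corresponding map for [deltaD] and [epsD]. *)
Lemma is_coalgebra_transport C D (deltaC : C -> tensor C C) (epsC : C -> K)
    (deltaD : D -> tensor D D) (epsD : D -> K) (phi : C -> D) (psi : D -> C) :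
  linear phi -> linear psi -> cancel phi psi -> cancel psi phi ->
  (forall c, deltaC c = tmap psi psi (deltaD (phi c))) ->
  (forall c, epsC c = epsD (phi c)) ->
  is_coalgebra deltaD epsD -> is_coalgebra deltaC epsC.
Proof.
move=> phil psil phiK psiK /funext dC /funext eC [dl el coassoc cul cur].
have ppl := tmap_linear psil psil; have idl := @id_linear C.
have dCl : linear deltaC.
  by rewrite dC; exact: comp_linear ppl (comp_linear dl phil).
have eCl : scalar epsC by rewrite eC => a x y; rewrite phil el.
split=> // [c|c|c].
- rewrite {2 4}dC !tmap_comp //.
  transitivity (tmap psi (tmap psi psi) (tassoc (tmap deltaD id (deltaD (phi c))))).
    rewrite -tassoc_tmap // tmap_comp //; congr tassoc.
    by apply: eq_tmap => // d; rewrite dC psiK.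
  rewrite coassoc tmap_comp //.
  by apply: eq_tmap => // d; rewrite dC psiK.
- have bl (b : C) := form_scale_linear b eCl.
  have br a := @scale_linear K C (epsC a).
  have bl' (b : D) := form_scale_linear b el.
  have br' a := @scale_linear K D (epsD a).
  rewrite dC -[RHS]phiK -[in RHS](cul (phi c)); move: (deltaD (phi c)).
  apply: tensor_ext.
  + exact: comp_linear (tlift_linear bl br) ppl.
  + exact: comp_linear psil (tlift_linear bl' br').
  by move=> a b; rewrite tmap_tens // !tlift_tens // eC psiK (linearZE psil).
- have br (a : C) := form_scale_linear a eCl.
  have bl b := @scale_linear K C (epsC b).
  have br' (a : D) := form_scale_linear a el.
  have bl' b := @scale_linear K D (epsD b).
  rewrite dC -[RHS]phiK -[in RHS](cur (phi c)); move: (deltaD (phi c)).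
  apply: tensor_ext.
  + exact: comp_linear (tlift_linear bl br) ppl.
  + exact: comp_linear psil (tlift_linear bl' br').
  by move=> a b; rewrite tmap_tens // !tlift_tens // eC psiK (linearZE psil).
Qed.

End TensorMaps.

(** * Contraction and reversal in the tensor algebra *)

Section TensorAlgebra.
Context {K : fieldType} (V : lmodType K).
Implicit Types (a b : TA V) (chi : V -> K).

Lemma TA_ext (M : lmodType K) (f g : TA V -> M) : linear f -> linear g ->
  (forall n (x : tpow V n), f (TAin x) = g (TAin x)) -> f =1 g.
Proof.
move=> fl gl fg a; elim/(@TA_ind K V): a => [|x y fx fy|//].
  by rewrite (linear0E fl) (linear0E gl).
by rewrite (linearDE fl) (linearDE gl) fx fy.
Qed.

Lemma TAin0 n : TAin (0 : tpow V n) = 0.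
Proof. exact: (linear0E (@TAin_linear _ _ _)). Qed.

Lemma TAinZ n c (x : tpow V n) : TAin (c *: x) = c *: TAin x.
Proof. exact: (linearZE (@TAin_linear _ _ _)). Qed.

Lemma TAin_scalar (c : K) : TAin (n := 0) (c : tpow V 0) = c *: (1 : TA V).
Proof. by rewrite -[RHS]TAinZ; congr TAin; rewrite /GRing.scale /= mulr1. Qed.

Lemma TAcomp_linear n : linear (@TAcomp K V n). Proof. by []. Qed.

Lemma TAcomp_in n (x : tpow V n) : TAcomp n (TAin x) = x.
Proof. exact: dsin_in. Qed.

Lemma TAhomogE n a : TAhomog n a -> a = TAin (TAcomp n a).
Proof. by case=> x ->; rewrite TAcomp_in. Qed.

Lemma TAhomog_lin n (c : K) a b :
  TAhomog n a -> TAhomog n b -> TAhomog n (c *: a + b).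
Proof.
by case=> x -> [y ->]; exists (c *: x + y); rewrite TAin_linear.
Qed.

Lemma TAhomogD n a b : TAhomog n a -> TAhomog n b -> TAhomog n (a + b).
Proof. by move=> ha hb; rewrite -[a]scale1r; apply: TAhomog_lin. Qed.

Lemma TAhomog0 n : TAhomog n (0 : TA V).
Proof. by exists 0; rewrite TAin0. Qed.

Lemma mulr_linearl b : linear (fun a => a * b).
Proof. exact: TAmul_linearl. Qed.
Lemma mulr_linearr a : linear (fun b => a * b).
Proof. exact: TAmul_linearr. Qed.

Definition TAvec (v : V) : TA V := TAin (tens v 1 : tpow V 1).

Lemma TAvec_linear : linear TAvec.
Proof. by move=> c u v; rewrite /TAvec tens_linearl TAin_linear. Qed.

Lemma TAvec_mul v n (x : tpow V n) : TAvec v * TAin x = TAin (tens v x : tpow V n.+1).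
Proof. by rewrite TAin_mul (tmul_tens v (1 : tpow V 0) x) /= scale1r. Qed.

(** In positive degree the tensor algebra is spanned by the products of a vector
    and a homogeneous element. *)
Lemma TAhomog_ext (M : lmodType K) n (f g : TA V -> M) : linear f -> linear g ->
  (forall v b, TAhomog n b -> f (TAvec v * b) = g (TAvec v * b)) ->
  forall a, TAhomog n.+1 a -> f a = g a.
Proof.
move=> fl gl fg _ [x ->].
have fl' := comp_linear fl (@TAin_linear K V n.+1).
have gl' := comp_linear gl (@TAin_linear K V n.+1).
move: x; apply: (tensor_ext fl' gl') => v x.
by rewrite -TAvec_mul; apply: fg; exists x.
Qed.

Section FirstFactor.
Context {M : lmodType K} (G : V -> TA V -> M).
Hypotheses (Gl : forall b, linear (G^~ b)) (Gr : forall v, linear (G v)).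

Let split_bl n (y : tpow V n) : linear (fun v => G v (TAin y)).
Proof. exact: Gl. Qed.
Let split_br n v : linear (fun y : tpow V n => G v (TAin y)).
Proof. exact: comp_linear (Gr v) (@TAin_linear K V n). Qed.

Definition split_component n : tpow V n -> M :=
  if n is n'.+1 return tpow V n -> M
  then tlift (fun v (y : tpow V n') => G v (TAin y)) else fun _ => 0.

Fact split_component_linear n : linear (@split_component n).
Proof.
case: n => [|n] c x y; first by rewrite /= scaler0 addr0.
exact: (tlift_linear (@split_bl n) (@split_br n)).
Qed.

(** The linear map on the tensor algebra that is zero in degree 0 and otherwise
    splits off the first factor. *)
Definition TAsplit : TA V -> M := dlift split_component.

Lemma TAsplit_linear : linear TAsplit.
Proof. exact: dlift_linear split_component_linear. Qed.

Lemma TAsplit_vec v b : TAsplit (TAvec v * b) = G v b.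
Proof.
move: b; apply: TA_ext => [||n x].
- exact: comp_linear TAsplit_linear (mulr_linearr _).
- exact: Gr.
rewrite TAvec_mul /TAsplit {1}/TAin dlift_dsin; last first.
  by move=> k; exact: (linear0E (@split_component_linear k)).
exact: (tlift_tens (@split_bl n) (@split_br n)).
Qed.

End FirstFactor.

Section Contraction.
Variable chi : V -> K.
Hypothesis chil : scalar chi.

(** Left contraction of tensors by a linear form, zero on scalars. *)
Definition cut : TA V -> TA V := TAsplit (fun v b => chi v *: b).

Let cut_bl (b : TA V) : linear (fun v => chi v *: b).
Proof. exact: form_scale_linear. Qed.
Let cut_br v : linear (fun b : TA V => chi v *: b).
Proof. exact: scale_linear. Qed.

Lemma cut_linear : linear cut.
Proof. exact: TAsplit_linear cut_bl cut_br. Qed.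

Lemma cut_vec v b : cut (TAvec v * b) = chi v *: b.
Proof. exact: TAsplit_vec cut_bl cut_br v b. Qed.

Lemma cut_homog n a : TAhomog n.+1 a -> TAhomog n (cut a).
Proof.
case=> x ->; elim/(@tensor_ind K): x => [|x y Hx Hy|v x].
- by rewrite TAin0 (linear0E cut_linear); apply: TAhomog0.
- by rewrite (linearDE (@TAin_linear _ _ _)) (linearDE cut_linear); apply: TAhomogD.
by rewrite -TAvec_mul cut_vec; exists (chi v *: x); rewrite TAinZ.
Qed.

(** The degree of [a] has to be positive: a scalar is contracted to zero, but its
    product with [b] need not be. *)
Lemma cut_mul n a b : TAhomog n.+1 a -> cut (a * b) = cut a * b.
Proof.
move: a; apply: TAhomog_ext.
- exact: comp_linear cut_linear (mulr_linearl _).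
- exact: comp_linear (mulr_linearl _) cut_linear.
by move=> v c _; rewrite -mulrA !cut_vec scalerAl.
Qed.

End Contraction.

(** A tensor power of positive degree is [V] tensored with the preceding one, so
    [tens_eq0] applies with all linear forms on [V]. *)
Lemma cut_separates n a : TAhomog n.+1 a ->
  (forall chi, scalar chi -> cut chi a = 0) -> a = 0.
Proof.
case=> x -> cut0; rewrite [x](_ : _ = 0) ?TAin0 //.
apply: (@tens_eq0 K V (tpow V n) {chi : V -> K | scalar chi} (fun i => sval i)).
- by move=> i; exact: svalP.
- move=> v v0; apply/eqP/negP => /negP/(ex_form)[chi chil].
  by have /= -> := v0 (exist _ chi chil); rewrite eqxx.
case=> chi chil /=; rewrite -[RHS](TAcomp_in (0 : tpow V n)) TAin0 -(cut0 chi chil).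
have bl (y : tpow V n) := form_scale_linear y chil.
have br v := @scale_linear K (tpow V n) (chi v).
move: (x : tensor V (tpow V n)); apply: tensor_ext.
- exact: tlift_linear bl br.
- exact: comp_linear (@TAcomp_linear n) (comp_linear (cut_linear chil) (@TAin_linear K V n.+1)).
by move=> v y; rewrite tlift_tens // -TAvec_mul cut_vec // -TAinZ TAcomp_in.
Qed.

Fixpoint trev n : tpow V n -> TA V :=
  if n is n'.+1 return tpow V n -> TA V
  then tlift (fun v x => @trev n' x * TAvec v)
  else fun c : K => TAin (n := 0) c.

Lemma trev_bilin n : linear (@trev n) /\
  ((forall x : tpow V n, linear (fun v => trev x * TAvec v)) /\
   (forall v, linear (fun x : tpow V n => trev x * TAvec v))).
Proof.
elim: n => [|n [IH [IHl IHr]]].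
  split; first exact: (@TAin_linear K V 0).
  split=> [x c u v|v c x y]; first by rewrite TAvec_linear mulr_linearr.
  by rewrite [trev (_ + _)](@TAin_linear K V 0 c x y) mulr_linearl.
have trl : linear (@trev n.+1) by exact: tlift_linear.
split=> //; split=> [x c u v|v c x y]; first by rewrite TAvec_linear mulr_linearr.
by rewrite trl mulr_linearl.
Qed.

Lemma trev_linear n : linear (@trev n). Proof. exact: (trev_bilin n).1. Qed.
Lemma trev_tens n v (x : tpow V n) :
  trev (tens v x : tpow V n.+1) = trev x * TAvec v.
Proof. by have [_ [bl br]] := trev_bilin n; exact: tlift_tens. Qed.

Definition TArev : TA V -> TA V := dlift trev.

Lemma TArev_linear : linear TArev.
Proof. exact: dlift_linear trev_linear. Qed.
Lemma TArev_in n (x : tpow V n) : TArev (TAin x) = trev x.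
Proof. by rewrite /TArev /TAin dlift_dsin // => k; exact: (linear0E (@trev_linear k)). Qed.

Lemma TArev_vecM v b : TArev (TAvec v * b) = TArev b * TAvec v.
Proof.
move: b; apply: TA_ext.
- exact: comp_linear TArev_linear (mulr_linearr _).
- exact: comp_linear (mulr_linearl _) TArev_linear.
by move=> n x; rewrite TAvec_mul !TArev_in trev_tens.
Qed.

Lemma TArev_scalar (c : K) : TArev (TAin (n := 0) c) = TAin (n := 0) (c : tpow V 0).
Proof. exact: TArev_in. Qed.

(** Induction on the degree. *)
Lemma TA_vec_ext (M : lmodType K) (f g : TA V -> M) : linear f -> linear g ->
  f 1 = g 1 -> (forall v b, f b = g b -> f (TAvec v * b) = g (TAvec v * b)) ->
  f =1 g.
Proof.
move=> fl gl fg1 fgM; apply: TA_ext => // n; elim: n => [|n IH] x.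
  by rewrite TAin_scalar (linearZE fl) (linearZE gl) fg1.
apply: (@TAhomog_ext _ n) => //; last by exists x.
by move=> v _ [y ->]; exact/fgM/IH.
Qed.

Lemma TArev1 : TArev 1 = 1. Proof. exact: (TArev_scalar 1). Qed.

Lemma TArevM a b : TArev (a * b) = TArev b * TArev a.
Proof.
move: a; apply: TA_vec_ext.
- exact: comp_linear TArev_linear (mulr_linearl _).
- exact: comp_linear (mulr_linearr _) TArev_linear.
- by rewrite mul1r TArev1 mulr1.
by move=> v c IH; rewrite -(mulrA (TAvec v) c b) TArev_vecM (TArev_vecM v c) IH mulrA.
Qed.

Lemma TArev_vec v : TArev (TAvec v) = TAvec v.
Proof. by rewrite -[TAvec v]mulr1 TArev_vecM TArev1 mul1r mulr1. Qed.

Lemma TArevK : involutive TArev.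
Proof.
apply: TA_vec_ext.
- exact: comp_linear TArev_linear TArev_linear.
- exact: id_linear.
- by rewrite !TArev1.
by move=> v b IH; rewrite TArev_vecM TArevM TArev_vec IH.
Qed.

Lemma TArev_homog n a : TAhomog n a -> TAhomog n (TArev a).
Proof.
case=> x ->; elim: n x => [|n IH] x; first by rewrite TArev_scalar; exists x.
elim/(@tensor_ind K): x => [|x y Hx Hy|v x].
- by rewrite TAin0 (linear0E TArev_linear); apply: TAhomog0.
- rewrite (linearDE (@TAin_linear _ _ _)) (linearDE TArev_linear).
  exact: TAhomogD.
rewrite -TAvec_mul TArev_vecM -addn1; apply: TAhomogM => //.
by exists (tens v 1).
Qed.

End TensorAlgebra.

(** * Coordinates of graded maps *)

Section GradedMaps.
Context {K : fieldType} {V : lmodType K}.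
Local Notation maps := ({poly K} -> TA V).
Implicit Types (F G : maps) (t u : {poly K}).

Lemma poly_ext (M : lmodType K) (f g : {poly K} -> M) : linear f -> linear g ->
  (forall n, f 'X^n = g 'X^n) -> f =1 g.
Proof.
move=> fl gl fg p; rewrite -[p]coefK poly_def (linear_sumE fl) (linear_sumE gl).
by apply: eq_bigr => i _; rewrite (linearZE fl) (linearZE gl) fg.
Qed.

Lemma graded_mapX F n : graded_map F -> TAhomog n (F 'X^n).
Proof. by case=> _ /(_ n 1); rewrite scale1r. Qed.

Lemma graded_mapI F : linear F -> (forall n, TAhomog n (F 'X^n)) -> graded_map F.
Proof.
move=> Fl Fh; split=> // n c; rewrite (linearZE Fl) -[_ *: _]addr0.
by apply: TAhomog_lin => //; apply: TAhomog0.
Qed.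

Lemma graded_map1 F : graded_map F -> F 1 = (TAcomp 0 (F 1) : K) *: 1.
Proof.
move=> /(@graded_mapX _ 0); rewrite expr0 => /TAhomogE {1}->.
exact: TAin_scalar.
Qed.

(** Left contraction of [F (X t)] by a form. It maps graded maps to graded maps,
    since [X] raises the degree and the contraction lowers it, and it acts on the
    left factors only of a product formula for [F]. *)
Definition lower (chi : V -> K) F : maps := fun t => cut chi (F ('X * t)).

Lemma mulX_linear F : linear F -> linear (fun t => F ('X * t)).
Proof. by move=> Fl c x y; rewrite mulrDr -scalerAr Fl. Qed.

Lemma lower_graded chi F : scalar chi -> graded_map F -> graded_map (lower chi F).
Proof.
move=> chil Fg; apply: graded_mapI => [|n].
  exact: comp_linear (cut_linear chil) (mulX_linear Fg.1).
by apply: cut_homog => //; rewrite -exprS; apply: graded_mapX.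
Qed.

Lemma lower_linear chi : scalar chi -> linear (lower chi : maps -> maps).
Proof. by move=> chil c F G; apply: funext => t; rewrite /lower (cut_linear chil). Qed.

(** The values [F (X t)] have no component of degree 0, so the contraction
    acts on the left factor. *)
Lemma lower_mul chi F t (b : TA V) : scalar chi -> graded_map F ->
  cut chi (F ('X * t) * b) = lower chi F t * b.
Proof.
move=> chil Fg; have Xl := mulX_linear Fg.1; move: t; apply: poly_ext.
- exact: comp_linear (cut_linear chil) (comp_linear (mulr_linearl b) Xl).
- exact: comp_linear (mulr_linearl b) (comp_linear (cut_linear chil) Xl).
by move=> n; apply: (@cut_mul _ _ _ _ n) => //; rewrite -exprS; apply: graded_mapX.
Qed.

Definition form : Type := {chi : V -> K | scalar chi}.

Fixpoint lowers (s : seq form) F : maps :=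
  if s is chi :: s' then lowers s' (lower (sval chi) F) else F.

Lemma lowers_linear s : linear (lowers s : maps -> maps).
Proof.
elim: s => [//|[chi chil] s IH] c F G /=.
by rewrite lower_linear // IH.
Qed.

Lemma lowers_graded s F : graded_map F -> graded_map (lowers s F).
Proof.
by elim: s F => [//|[chi chil] s IH] F Fg; apply/IH/lower_graded.
Qed.

Lemma lowers_shift s F u t : lowers s (fun t => F (t * u)) t = lowers s F (t * u).
Proof.
elim: s F => [//|[chi chil] s IH] F /=; rewrite -IH; congr (lowers s _ t).
by apply: funext => x; rewrite /lower mulrA.
Qed.

Lemma lowers_sum J (r : seq J) (g : J -> maps) (b : J -> TA V) s F :
  (forall j, graded_map (g j)) -> (forall t, F t = \sum_(j <- r) g j t * b j) ->
  forall t, lowers s F t = \sum_(j <- r) lowers s (g j) t * b j.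
Proof.
elim: s g F => [//|[chi chil] s IH] g F gg FE /=; apply: IH => [j|t].
  exact: lower_graded.
rewrite /lower FE (linear_sumE (cut_linear chil)); apply: eq_bigr => j _.
exact: lower_mul.
Qed.

Lemma lowers_representative s F : representative F -> representative (lowers s F).
Proof.
elim: s F => [//|[chi chil] s IH] F [Fg [n [g [h [gg hg FE]]]]] /=; apply: IH.
split; first exact: lower_graded.
exists n, (fun i => lower chi (g i)), h; split=> // [i|t u].
  exact: lower_graded.
rewrite /lower mulrA FE (linear_sumE (cut_linear chil)).
by apply: eq_bigr => i _; apply: lower_mul.
Qed.

(** Iterated contractions evaluated at [1] are the coordinates of a graded map
    with respect to all products of forms. *)
Definition coordinate (s : seq form) F : K := TAcomp 0 (lowers s F 1).

Lemma coordinate_scalar s : scalar (coordinate s).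
Proof. by move=> c F G; rewrite /coordinate lowers_linear. Qed.

(** In degree [n] this is [n] applications of the separation of tensors by left
    contractions: the value of [F] at [X^(n+1)] contracts to the value of
    [lower chi F] at [X^n]. *)
Lemma coordinate_separates F :
  graded_map F -> (forall s, coordinate s F = 0) -> F = 0.
Proof.
move=> Fg F0; apply: funext; apply: poly_ext => //.
- exact: Fg.1.
- by move=> c x y; rewrite [RHS]addr0 scaler0.
move=> n; elim: n F Fg F0 => [|n IH] F Fg F0.
  by rewrite expr0 graded_map1 // [TAcomp 0 _](F0 [::]) scale0r.
apply: (@cut_separates _ _ n); first exact: graded_mapX.
move=> chi chil; rewrite exprS; apply: (IH (lower chi F)).
  exact: lower_graded.
by move=> s; apply: (F0 (exist _ chi chil :: s)).
Qed.

(** At [1] the contracted left factors are scalars, namely the coordinates. *)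
Lemma coordinate_contract J (r : seq J) (g : J -> maps) (b : J -> TA V) s F :
  (forall j, graded_map (g j)) -> (forall t, F t = \sum_(j <- r) g j t * b j) ->
  \sum_(j <- r) coordinate s (g j) *: b j = lowers s F 1.
Proof.
move=> gg FE; rewrite (lowers_sum s gg FE); apply: eq_bigr => j _.
by rewrite (graded_map1 (lowers_graded s (gg j))) -scalerAl mul1r.
Qed.

End GradedMaps.

(** * Representative factors of representative maps *)

Section RepresentativeFamilies.
Context {K : fieldType} {V : lmodType K}.
Local Notation maps := ({poly K} -> TA V).
Implicit Types (F G : maps) (l : seq (maps * maps)).

Definition splits F l : Prop :=
  forall t u, F (t * u) = \sum_(p <- l) p.1 t * p.2 u.

Lemma representative_graded F : representative F -> graded_map F.
Proof. by case. Qed.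

Lemma representative0 : representative (0 : maps).
Proof. by have [/asboolP] := RepBL_closed V. Qed.

Lemma representative_lin (c : K) F G :
  representative F -> representative G -> representative (c *: F + G).
Proof.
move=> /asboolP HF /asboolP HG; have [_ H] := RepBL_closed V.
by apply/asboolP; apply: H.
Qed.

Lemma mul_eval_bilin (t u : {poly K}) :
  (forall h : maps, linear (fun g : maps => g t * h u)) /\
  (forall g : maps, linear (fun h : maps => g t * h u)).
Proof.
by split=> [h c f g|g c f h]; [apply: mulr_linearl|apply: mulr_linearr].
Qed.

(** Contracting the left entries of a product formula for [F] yields iterated
    contractions of [F], and these are again representative. So the right
    entries may be taken representative. *)
Lemma splits_representative_right (P : maps -> Prop) F l :
  (forall c f g, P f -> P g -> P (c *: f + g)) ->
  (forall f, P f -> graded_map f) -> representative F -> splits F l ->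
  (forall p, p \in l -> P p.1) ->
  exists2 l', splits F l' & forall p, p \in l' -> P p.1 /\ representative p.2.
Proof.
move=> Plin Pgraded Frep Fl Pl.
have [|s|l' Pl' ll'] := @tens_reduce _ maps maps P (@representative K V) _
    (@coordinate K V) Plin representative0 representative_lin
    (@coordinate_scalar K V) _ l Pl.
- by move=> f /Pgraded; apply: coordinate_separates.
- rewrite (_ : \sum_(_ <- _) _ = lowers s F); first exact: lowers_representative.
  (* [coordinate_contract] asks for graded maps at all indices. *)
  pose g (p : maps * maps) : maps := if p \in l then p.1 else 0.
  apply: funext => u; rewrite fct_sumE -[u in RHS]mul1r -lowers_shift.
  rewrite -(@coordinate_contract _ _ _ l g (fun p => p.2 u)).
  + by rewrite [LHS]big_seq [RHS]big_seq; apply: eq_bigr => p pl; rewrite /g pl.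
  + move=> p; rewrite /g; case: ifP => [/Pl/Pgraded//|_]; exact: graded_map0.
  + by move=> t; rewrite Fl big_seq [RHS]big_seq; apply: eq_bigr => p pl; rewrite /g pl.
exists l' => // t u.
have [bl br] := mul_eval_bilin t u.
have := congr1 (tlift (fun g h : maps => g t * h u)) ll'.
rewrite !(linear_sumE (tlift_linear bl br)) Fl => E.
by rewrite -(eq_bigr _ (fun p _ => tlift_tens bl br p.1 p.2)) E; apply: eq_bigr => p _;
  rewrite tlift_tens.
Qed.

Definition frev F : maps := fun t => TArev (F t).

Lemma frevK : involutive frev.
Proof. by move=> F; apply: funext => t; rewrite /frev TArevK. Qed.

Lemma frev_graded F : graded_map F -> graded_map (frev F).
Proof.
move=> Fg; apply: graded_mapI => [|n].
  exact: comp_linear (@TArev_linear _ _) Fg.1.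
exact/TArev_homog/graded_mapX.
Qed.

(** Reversal exchanges the factors of a product of tensors, and polynomials
    commute. *)
Lemma frev_splits F l :
  splits F l -> splits (frev F) [seq (frev p.2, frev p.1) | p <- l].
Proof.
move=> Fl t u; rewrite big_map /frev mulrC Fl (linear_sumE (@TArev_linear _ _)).
by apply: eq_bigr => p _; rewrite TArevM.
Qed.

Lemma frev_representative F : representative F -> representative (frev F).
Proof.
move=> [Fg [n [g [h [gg hg FE]]]]]; split; first exact: frev_graded.
exists n, (fun i => frev (h i)), (fun i => frev (g i)).
split=> [i|i|t u]; [exact: frev_graded|exact: frev_graded|].
rewrite /frev mulrC FE (linear_sumE (@TArev_linear _ _)).
by apply: eq_bigr => i _; rewrite TArevM.
Qed.

(** Reversal of tensors exchanges the two sides of a product formula, so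
    improving the right entries twice makes all entries representative. *)
Lemma splits_representative F : representative F ->
  exists2 l, splits F l & forall p, p \in l -> representative p.1 /\ representative p.2.
Proof.
move=> Frep; have [Fg [n [g [h [gg hg FE]]]]] := Frep.
pose l0 := [seq (g i, h i) | i <- enum 'I_n].
have Fl0 : splits F l0 by move=> t u; rewrite FE big_map big_enum.
have [p|l1 Fl1 Hl1] := splits_representative_right (@graded_map_closed K V)
    (fun f fg => fg) Frep Fl0 _.
  by case/mapP=> i _ ->; apply: gg.
have [p|l2 Fl2 Hl2] := splits_representative_right representative_lin
    representative_graded (frev_representative Frep) (frev_splits Fl1) _.
  by case/mapP=> q /Hl1[_ /frev_representative ?] ->.
exists [seq (frev p.2, frev p.1) | p <- l2].
  by rewrite -[F]frevK; apply: frev_splits.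
by move=> _ /mapP[p /Hl2[Hp1 Hp2] ->]; split; apply: frev_representative.
Qed.

End RepresentativeFamilies.

(** * The coalgebra of representative maps *)

Section RepBLCoalgebra.
Context {K : fieldType} {V : lmodType K}.
Local Notation R := (RepBL V).
Implicit Types (f g h : R) (t u w : {poly K}).

Lemma RepBL_representative f : representative f.
Proof. by case: f => f Hf; apply/asboolP. Qed.

Lemma RepBL_graded f : graded_map f.
Proof. exact: (RepBL_representative f).1. Qed.

Lemma RepBL_lin f : linear f. Proof. exact: (RepBL_graded f).1. Qed.

Lemma RepBL_ext f g : (forall n, f 'X^n = g 'X^n) -> f = g.
Proof.
move=> fg; apply: val_inj; apply: funext; apply: poly_ext => //; exact: RepBL_lin.
Qed.

Lemma RepBL_evalD c f g t : (c *: f + g) t = c *: f t + g t.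
Proof. by []. Qed.

Definition RepBL_of (F : {poly K} -> TA V) : R := insubd 0 F.

Lemma RepBL_ofE F : representative F -> RepBL_fun (RepBL_of F) = F.
Proof. by move=> HF; rewrite -[LHS]/(val _) insubdK //; apply/asboolP. Qed.

(** Tensors whose left factor is [R] are detected by evaluating the left entries
    at polynomials, provided the functions [rho] do so for the right entries. *)
Lemma tens_eval_eq0 (W : lmodType K) (T : Type) (rho : W -> T -> TA V) :
  (forall x, linear (rho^~ x)) -> (forall b, (forall x, rho b x = 0) -> b = 0) ->
  forall z : tensor R W,
  (forall t x, tlift (fun (a : R) b => a t * rho b x) z = 0) -> z = 0.
Proof.
move=> rhol rho_inj z z0.
have lamS s : scalar (fun f : R => coordinate s f).
  by move=> c f g; rewrite -coordinate_scalar; congr coordinate; apply: funext => t; exact: RepBL_evalD.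
apply: (tens_eq0 lamS) => [f f0|s].
  by apply: val_inj; apply: coordinate_separates => //; apply: RepBL_graded.
have [l zE] := tens_sum z; apply: rho_inj => x.
have bl (b : W) := form_scale_linear b (lamS s).
have br (a : R) := @scale_linear K W (coordinate s a).
rewrite zE (linear_sumE (tlift_linear bl br)) (linear_sumE (rhol x)).
have FE t : (0 : {poly K} -> TA V) t = \sum_(p <- l) p.1 t * rho p.2 x.
  have bl' b : linear (fun a : R => a t * rho b x).
    by move=> c f g; rewrite RepBL_evalD mulr_linearl.
  have br' (a : R) : linear (fun b => a t * rho b x).
    by move=> c f g; rewrite rhol mulr_linearr.
  rewrite -[LHS](z0 t x) zE (linear_sumE (tlift_linear bl' br')).
  by apply: eq_bigr => p _; rewrite tlift_tens.
have := coordinate_contract s (fun p : R * W => RepBL_graded p.1) FE.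
rewrite (linear0E (lowers_linear s)) => E; rewrite -[RHS]E.
apply: eq_bigr => p _.
by rewrite tlift_tens // (linearZE (rhol x)).
Qed.

Definition pair_eval (z : tensor R R) (tu : {poly K} * {poly K}) : TA V :=
  tlift (fun g h : R => g tu.1 * h tu.2) z.

Let pair_bl tu h : linear (fun g : R => g tu.1 * h tu.2).
Proof. by move=> c f g; rewrite RepBL_evalD mulr_linearl. Qed.
Let pair_br tu g : linear (fun h : R => g tu.1 * h tu.2).
Proof. by move=> c f h; rewrite RepBL_evalD mulr_linearr. Qed.

Lemma pair_eval_linear tu : linear (pair_eval^~ tu).
Proof. exact: tlift_linear (pair_bl tu) (pair_br tu). Qed.
Lemma pair_eval_tens g h t u : pair_eval (tens g h) (t, u) = g t * h u.
Proof. exact: (tlift_tens (pair_bl (t, u)) (pair_br (t, u))). Qed.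

Lemma pair_eval_eq0 z : (forall tu, pair_eval z tu = 0) -> z = 0.
Proof.
move=> z0; apply: (@tens_eval_eq0 R {poly K} (fun h u => h u)) => [u c f g|h h0|t u].
- exact: RepBL_evalD.
- by apply: RepBL_ext => n; rewrite h0.
exact: (z0 (t, u)).
Qed.

Lemma pair_eval_inj z z' : (forall t u, pair_eval z (t, u) = pair_eval z' (t, u)) -> z = z'.
Proof.
move=> zz'; apply/eqP; rewrite -subr_eq0; apply/eqP/pair_eval_eq0 => -[t u].
rewrite -scaleN1r addrC (pair_eval_linear (t, u)) zz' scaleN1r addNr //.
Qed.

Definition triple_eval (z : tensor R (tensor R R)) t u w : TA V :=
  tlift (fun (g : R) y => g t * pair_eval y (u, w)) z.

Let triple_bl t u w y : linear (fun g : R => g t * pair_eval y (u, w)).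
Proof. by move=> c f g; rewrite RepBL_evalD mulr_linearl. Qed.
Let triple_br t u w g : linear (fun y => (g : R) t * pair_eval y (u, w)).
Proof. by move=> c x y; rewrite (pair_eval_linear (u, w)) mulr_linearr. Qed.

Lemma triple_eval_linear t u w : linear (fun z => triple_eval z t u w).
Proof. exact: tlift_linear (triple_bl t u w) (triple_br t u w). Qed.
Lemma triple_eval_tens g y t u w :
  triple_eval (tens g y) t u w = g t * pair_eval y (u, w).
Proof. exact: tlift_tens (triple_bl t u w) (triple_br t u w) _ _. Qed.

Lemma triple_eval_inj z z' :
  (forall t u w, triple_eval z t u w = triple_eval z' t u w) -> z = z'.
Proof.
move=> zz'; apply/eqP; rewrite -subr_eq0; apply/eqP.
apply: (tens_eval_eq0 pair_eval_linear pair_eval_eq0) => t [u w].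
rewrite -[LHS]/(triple_eval _ t u w) -scaleN1r addrC triple_eval_linear zz'.
by rewrite scaleN1r addNr.
Qed.

Lemma BL_family_exists f : exists n (g h : 'I_n -> R), BL_family f g h.
Proof.
have [l fl Hl] := splits_representative (RepBL_representative f).
have l_nth (i : 'I_(size l)) : nth (0, 0) l i \in l by rewrite mem_nth.
exists (size l), (fun i => RepBL_of (nth (0, 0) l i).1),
  (fun i => RepBL_of (nth (0, 0) l i).2) => t u.
rewrite fl (big_nth (0, 0)) big_mkord; apply: eq_bigr => i _.
by have [H1 H2] := Hl _ (l_nth i); rewrite !RepBL_ofE.
Qed.

Lemma pair_eval_family n (g h : 'I_n -> R) t u :
  pair_eval (\sum_(i < n) tens (g i) (h i)) (t, u) = \sum_(i < n) g i t * h i u.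
Proof.
rewrite (linear_sumE (pair_eval_linear (t, u))).
by apply: eq_bigr => i _; rewrite pair_eval_tens.
Qed.

(** The value of [deltaBL f] is the only tensor whose evaluations are those of
    the bilinear map [t, u |-> f (t u)]. *)
Lemma deltaBL_eval f t u : pair_eval (deltaBL f) (t, u) = f (t * u).
Proof.
have [n [g [h fgh]]] := BL_family_exists f.
rewrite /deltaBL; case: xgetP => [z _ [_ /(_ n g h fgh) ->]|none].
  by rewrite pair_eval_family fgh.
case: (none (\sum_(i < n) tens (g i) (h i))); split; first by exists n, g, h.
move=> n' g' h' fgh'; apply: pair_eval_inj => x y.
by rewrite !pair_eval_family -fgh -fgh'.
Qed.

Lemma deltaBL_unique f z : (forall t u, pair_eval z (t, u) = f (t * u)) -> deltaBL f = z.
Proof. by move=> zf; apply: pair_eval_inj => t u; rewrite deltaBL_eval zf. Qed.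

Lemma deltaBL_linear : linear (@deltaBL K V).
Proof.
move=> c f g; apply: deltaBL_unique => t u.
by rewrite (pair_eval_linear (t, u)) !deltaBL_eval RepBL_evalD.
Qed.

Lemma epsBL_scalar : scalar (@epsBL K V).
Proof. by move=> c f g; rewrite /epsBL RepBL_evalD. Qed.

Lemma RepBL_1 f : f 1 = epsBL f *: 1.
Proof. exact/graded_map1/RepBL_graded. Qed.

(** Both sides evaluate at [t, u, w] to [f (t u w)]. *)
Lemma deltaBL_coassoc f :
  tassoc (tmap (@deltaBL K V) id (deltaBL f)) = tmap id (@deltaBL K V) (deltaBL f).
Proof.
have dl := deltaBL_linear; have il := @id_linear K R.
apply: triple_eval_inj => t u w; transitivity (f (t * u * w)).
  rewrite -deltaBL_eval; move: (deltaBL f); apply: tensor_ext.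
  - apply: comp_linear (triple_eval_linear t u w) _.
    exact: comp_linear tassoc_linear (tmap_linear dl il).
  - exact: pair_eval_linear.
  move=> g h; rewrite tmap_tens // pair_eval_tens -deltaBL_eval.
  move: (deltaBL g); apply: tensor_ext.
  - apply: comp_linear (triple_eval_linear t u w) _.
    exact: comp_linear tassoc_linear (tens_linearl h).
  - exact: comp_linear (mulr_linearl _) (pair_eval_linear (t, u)).
  by move=> a b; rewrite tassoc_tens triple_eval_tens !pair_eval_tens mulrA.
rewrite -mulrA -deltaBL_eval; move: (deltaBL f); apply: tensor_ext.
- exact: pair_eval_linear.
- exact: comp_linear (triple_eval_linear t u w) (tmap_linear il dl).
by move=> g h; rewrite tmap_tens // pair_eval_tens triple_eval_tens deltaBL_eval.
Qed.

Lemma deltaBL_counitl f : tlift (fun a b => epsBL a *: b) (deltaBL f) = f.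
Proof.
have bl (b : R) := form_scale_linear b epsBL_scalar.
have br (a : R) := @scale_linear K R (epsBL a).
apply: RepBL_ext => n; rewrite -['X^n in RHS]mul1r -deltaBL_eval.
have evl : linear (fun g : R => g 'X^n) by move=> c x y; exact: RepBL_evalD.
move: (deltaBL f); apply: tensor_ext.
- exact: comp_linear evl (tlift_linear bl br).
- exact: pair_eval_linear.
move=> g h; rewrite tlift_tens // pair_eval_tens RepBL_1 -scalerAl mul1r.
exact: (linearZE evl).
Qed.

Lemma deltaBL_counitr f : tlift (fun a b => epsBL b *: a) (deltaBL f) = f.
Proof.
have bl (b : R) := @scale_linear K R (epsBL b).
have br (a : R) := form_scale_linear a epsBL_scalar.
apply: RepBL_ext => n; rewrite -['X^n in RHS]mulr1 -deltaBL_eval.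
have evl : linear (fun g : R => g 'X^n) by move=> c x y; exact: RepBL_evalD.
move: (deltaBL f); apply: tensor_ext.
- exact: comp_linear evl (tlift_linear bl br).
- exact: pair_eval_linear.
move=> g h; rewrite tlift_tens // pair_eval_tens RepBL_1 -scalerAr mulr1.
exact: (linearZE evl).
Qed.

Lemma RepBL_is_coalgebra : is_coalgebra (@deltaBL K V) (@epsBL K V).
Proof.
split; [exact: deltaBL_linear|exact: epsBL_scalar|exact: deltaBL_coassoc| |].
- exact: deltaBL_counitl.
- exact: deltaBL_counitr.
Qed.

End RepBLCoalgebra.

(** * Tensor powers of the label space *)

Section FormalValues.
Context {K : fieldType} {V : lmodType K}.
Local Notation L := (lbl V).

(** The tensor product of the projections to [V] or [K] selected by [a], where
    [true] selects [V], with values read in the tensor algebra. Only the first [n]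
    entries of [a] matter, and missing entries select [K]. *)
Fixpoint project n (a : seq bool) : tpow L n -> TA V :=
  if n is n'.+1 return tpow L n -> TA V
  then tlift (fun x y => TAproj (head false a) x * @project n' (behead a) y)
  else fun c : K => TAin (n := 0) c.

Lemma project_bilin n : (forall a, linear (@project n a)) /\ forall b a,
  (forall y : tpow L n, linear (fun x => TAproj b x * project a y)) /\
  (forall x, linear (fun y : tpow L n => TAproj b x * project a y)).
Proof.
have key m : (forall a, linear (@project m a)) -> forall b a,
    (forall y : tpow L m, linear (fun x => TAproj b x * project a y)) /\
    (forall x, linear (fun y : tpow L m => TAproj b x * project a y)).
  move=> pl b a; split=> [y c u v|x c u v].
    by rewrite TAproj_linear mulr_linearl.
  by rewrite pl mulr_linearr.
suff pl : forall a, linear (@project n a) by split=> //; apply: key.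
elim: n => [|n IH] a; first exact: (@TAin_linear K V 0).
by have [bl br] := key n IH (head false a) (behead a); exact: tlift_linear.
Qed.

Lemma project_linear n a : linear (@project n a).
Proof. exact: (project_bilin n).1. Qed.

Lemma project_tens n a x (y : tpow L n) :
  project a (tens x y : tpow L n.+1) = TAproj (head false a) x * project (behead a) y.
Proof.
by have [bl br] := (project_bilin n).2 (head false a) (behead a); exact: tlift_tens.
Qed.

Lemma project_ptens n (a : n.-tuple bool) (x : n.-tuple L) :
  project a (ptens x) = \prod_(k < n) TAproj (tnth a k) (tnth x k).
Proof.
elim: n a x => [|n IH] a x; first by rewrite big_ord0.
case/tupleP: a => b a; case/tupleP: x => y x.
have -> : ptens [tuple of y :: x] = tens y (ptens x).
  by rewrite /= theadE; congr (tens _ (ptens _)); apply: val_inj.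
rewrite project_tens /= IH big_ord_recl !tnth0; congr (_ * _).
by apply: eq_bigr => i _; rewrite !tnthS.
Qed.

Lemma gval_project (s : gentree L) t (a : ptuple t) : gval s a = project a (gen s t).
Proof.
rewrite /gval /gen !tree_sumE (linear_sumE (project_linear _)).
by apply: eq_bigr => x _; rewrite project_ptens.
Qed.

(** On tensors whose degree is the number of factors [V] selected by [a], this is
    the inclusion of the selected summand into the [n]-th tensor power of
    [V (+) K]. *)
Fixpoint embed n (a : seq bool) : TA V -> tpow L n :=
  if n is n'.+1 return TA V -> tpow L n
  then fun x =>
    if head false a then TAsplit (fun v b => tens (v, 0 : K^o) (@embed n' (behead a) b)) x
    else tens (0 : V, 1 : K^o) (@embed n' (behead a) x)
  else fun x => TAcomp 0 x.

Fixpoint selections n : seq (seq bool) :=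
  if n is n'.+1
  then [seq true :: a | a <- selections n'] ++ [seq false :: a | a <- selections n']
  else [:: [::]].

Lemma pair_linear_l : linear (fun v : V => (v, 0) : L).
Proof. by move=> c u v; congr pair; rewrite /= scaler0 addr0. Qed.

Lemma embed_bilin n : (forall a, linear (@embed n a)) /\ forall a,
  (forall b : TA V, linear (fun v => tens ((v, 0) : L) (@embed n a b))) /\
  (forall v, linear (fun b : TA V => tens ((v, 0) : L) (@embed n a b))).
Proof.
have key m : (forall a, linear (@embed m a)) -> forall a,
    (forall b : TA V, linear (fun v => tens ((v, 0) : L) (@embed m a b))) /\
    (forall v, linear (fun b : TA V => tens ((v, 0) : L) (@embed m a b))).
  move=> el a; split=> [b c u v|v c x y].
    by rewrite pair_linear_l tens_linearl.
  by rewrite el tens_linearr.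
suff el : forall a, linear (@embed n a) by split=> //; apply: key.
elim: n => [|n IH] a; first exact: (@TAcomp_linear K V 0).
move=> c x y /=; have [bl br] := key n IH (behead a).
case: (head false a); first exact: (TAsplit_linear bl br).
by rewrite IH tens_linearr.
Qed.

(** The tensor power of [V (+) K] is the direct sum, over all selections of one
    of the two summands in each position, of tensor powers of [V]. *)
Lemma embed_project n (z : tpow L n) :
  z = \sum_(a <- selections n) embed n a (project a z).
Proof.
elim: n z => [|n IH] z; first by rewrite big_seq1; exact: (esym (@TAcomp_in K V 0 z)).
have el (m : nat) a : linear (fun z : tpow L m => embed m a (project a z)).
  exact: comp_linear ((embed_bilin m).1 a) (@project_linear m a).
move: z; apply: tensor_ext => [||x y].
- exact: id_linear.
- move=> c x y; rewrite scaler_sumr -big_split; apply: eq_bigr => a _.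
  exact: el n.+1 a c x y.
have trueE : \sum_(a <- selections n) embed n.+1 (true :: a)
    (project (true :: a) (tens x y : tpow L n.+1)) = tens ((x.1, 0) : L) y.
  rewrite [in RHS](IH y) (linear_sumE (tens_linearr _)); apply: eq_bigr => a _.
  have [bl br] := (embed_bilin n).2 a.
  by rewrite (project_tens (true :: a)) -[TAproj _ x]/(TAvec x.1) /= TAsplit_vec.
have falseE : \sum_(a <- selections n) embed n.+1 (false :: a)
    (project (false :: a) (tens x y : tpow L n.+1)) = tens ((0, x.2) : L) y.
  rewrite [in RHS](IH y) (linear_sumE (tens_linearr _)); apply: eq_bigr => a _.
  rewrite (project_tens (false :: a)) /= TAin_scalar -scalerAl mul1r.
  rewrite (linearZE ((embed_bilin n).1 a)) tensZr -tensZl; congr tens.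
  by congr pair; rewrite /= ?scaler0 // /GRing.scale /= mulr1.
rewrite [selections n.+1]/= big_cat !big_map /= -[LHS]/(tens x y).
transitivity (tens ((x.1, 0) : L) y + tens ((0, x.2) : L) y).
  by rewrite -tensDl; congr tens; case: x {trueE falseE} => v c; congr pair; rewrite ?addr0 ?add0r.
by apply/esym/congr2.
Qed.

Lemma size_selections n a : a \in selections n -> size a = n.
Proof.
elim: n a => [|n IH] a; first by rewrite inE => /eqP ->.
by rewrite mem_cat => /orP[] /mapP[b /IH <- ->].
Qed.

Lemma gval_eq_gen (s s' : gentree L) t :
  (forall a : ptuple t, gval s a = gval s' a) -> gen s t = gen s' t.
Proof.
move=> ss'; rewrite [LHS]embed_project [RHS]embed_project.
rewrite !big_seq; apply: eq_bigr => a /size_selections/eqP sa.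
by have := ss' (Tuple sa); rewrite !gval_project /= => ->.
Qed.

End FormalValues.

(** * From normal trees to representative maps *)

Section NormalValues.
Context {K : fieldType} {V : lmodType K}.
Implicit Types (s : gentree (lbl V)) (f : Nor V).

Lemma TAin_inj n : injective (@TAin K V n).
Proof. by move=> x y /(congr1 (TAcomp n)); rewrite !TAcomp_in. Qed.

Lemma nval_gval s t (a : ptuple t) n :
  normal s -> pdeg a = n -> TAin (nval s n) = gval s a.
Proof. by move=> ns <-; rewrite nvalP. Qed.

Lemma nval0 s : normal s -> TAin (nval s 0) = ((rlabel s).2 : K) *: (1 : TA V).
Proof.
move=> ns; rewrite (nval_gval (a := [tuple false] : ptuple gleaf)) //.
by rewrite gval_leaf theadE -TAin_scalar.
Qed.

Lemma nval1 s : normal s -> TAin (nval s 1) = TAvec (rlabel s).1.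
Proof.
move=> ns; rewrite (nval_gval (a := [tuple true] : ptuple gleaf)) //.
by rewrite gval_leaf theadE.
Qed.

(** Evaluating on a grading tree with left and right subtrees that carry
    degrees [m] and [n]. *)
Lemma nval_add s m n : normal s -> TAin (nval s (m + n)) =
  \sum_(j < arity s) TAin (nval (lchild j) m) * TAin (nval (rchild j) n).
Proof.
move=> ns; have [u [a am]] := pdeg_surj m; have [v [b bn]] := pdeg_surj n.
pose c : ptuple (gnode u v) := [tuple of a ++ b].
have lc : lptuple c = a.
  by apply: eq_from_tnth => i; rewrite tnth_mktuple tnth_lshift.
have rc : rptuple c = b.
  by apply: eq_from_tnth => i; rewrite tnth_mktuple tnth_rshift.
have cmn : pdeg c = (m + n)%N by rewrite pdeg_node lc rc am bn.
rewrite (nval_gval ns cmn) gval_node lc rc; apply: eq_bigr => j _.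
by rewrite (nval_gval (@normal_child _ _ _ Lft j ns) am) (nval_gval (@normal_child _ _ _ Rgt j ns) bn).
Qed.

(** The formal values are the projections [project a] of the generated tensors,
    and a tensor is the sum of its components in the summands. *)
Lemma nval_gen s s' : normal s -> normal s' ->
  (forall n, nval s n = nval s' n) <-> (forall t, gen s t = gen s' t).
Proof.
move=> ns ns'; split=> [ss' t|ss' n].
  by apply: gval_eq_gen => a; rewrite !nvalP // ss'.
have [t [a an]] := pdeg_surj n; apply: TAin_inj.
by rewrite (nval_gval ns an) (nval_gval ns' an) !gval_project ss'.
Qed.

Lemma genhom_tree s t :
  genhom s (dsin (E := fun _ : gtree => K^o) (i := t) 1) t = gen s t.
Proof.
set x := dsin _; rewrite -[LHS]/((x t : K) *: gen s t) /x dsin_in.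
exact: scale1r.
Qed.

Lemma genhom_gen s s' : genhom s = genhom s' <-> (forall t, gen s t = gen s' t).
Proof.
split=> [ss' t|ss'].
  by rewrite -[LHS]genhom_tree ss' genhom_tree.
by apply: funext => x; apply: dsumP => t /=; rewrite ss'.
Qed.

Lemma Nor_fun_lin c f g : Nor_fun (c *: f + g) = c *: Nor_fun f + Nor_fun g.
Proof. by []. Qed.

Lemma Nor_generated f : exists s, normal s /\ generates s f.
Proof. by case: f => f Hf; have /asboolP[s ns fs] := Hf; exists s. Qed.

Lemma nval_generates f s s' : normal s -> normal s' ->
  generates s f -> generates s' f -> forall n, nval s n = nval s' n.
Proof.
move=> ns ns' sf s'f; apply/(nval_gen ns ns')/genhom_gen.
by rewrite -sf -s'f.
Qed.

Section FromValues.
Variable (M : lmodType K) (w : nat -> M).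

(** The linear map with value [w n] at [X^n]. *)
Definition polylift (p : {poly K}) : M := \sum_(i < size p) p`_i *: w i.

Lemma polylift_wide N (p : {poly K}) : (size p <= N)%N -> polylift p = \sum_(i < N) p`_i *: w i.
Proof.
move=> pN; rewrite /polylift (big_ord_widen N (fun i => p`_i *: w i) pN) big_mkcond.
by apply: eq_bigr => i _; case: ltnP => // pi; rewrite nth_default // scale0r.
Qed.

Lemma polylift_linear : linear polylift.
Proof.
move=> c p q; pose N := maxn (size (c *: p + q)) (maxn (size p) (size q)).
rewrite !(@polylift_wide N) ?leq_max ?leqnn ?orbT // scaler_sumr -big_split.
by apply: eq_bigr => i _; rewrite coefD coefZ scalerDl scalerA.
Qed.

Lemma polyliftX n : polylift 'X^n = w n.
Proof.
rewrite (@polylift_wide n.+1) ?size_polyXn // (bigD1 ord_max) //= coefXn eqxx scale1r.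
rewrite big1 ?addr0 // => i; rewrite -val_eqE /= coefXn => /negPf ->.
exact: scale0r.
Qed.

End FromValues.

Definition values s : {poly K} -> TA V := polylift (fun n => TAin (nval s n)).

Lemma valuesX s n : values s 'X^n = TAin (nval s n).
Proof. exact: polyliftX. Qed.

Lemma values_graded s : graded_map (values s).
Proof.
apply: graded_mapI => [|n]; first exact: polylift_linear.
by rewrite valuesX; eexists.
Qed.

Lemma values_mul s : normal s -> forall t u,
  values s (t * u) = \sum_(j < arity s) values (lchild j) t * values (rchild j) u.
Proof.
move=> ns t u; have vl s' := (values_graded s').1.
have suml (J : finType) (F : J -> {poly K} -> TA V) :
    (forall j, linear (F j)) -> linear (fun t => \sum_j F j t).
  move=> Fl c x y; rewrite scaler_sumr -big_split.
  by apply: eq_bigr => j _; rewrite Fl.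
move: t; apply: poly_ext => [||m].
- by move=> c x y; rewrite mulrDl -scalerAl vl.
- by apply: suml => j; exact: comp_linear (mulr_linearl _) (vl _).
move: u; apply: poly_ext => [||n].
- by move=> c x y; rewrite mulrDr -scalerAr vl.
- by apply: suml => j; exact: comp_linear (mulr_linearr _) (vl _).
rewrite -exprD valuesX nval_add //; apply: eq_bigr => j _.
by rewrite !valuesX.
Qed.

Lemma values_representative s : normal s -> representative (values s).
Proof.
move=> ns; split; first exact: values_graded.
exists (arity s), (fun j => values (lchild j)), (fun j => values (rchild j)).
by split=> [i|i|]; [exact: values_graded|exact: values_graded|exact: values_mul].
Qed.

Definition toBL f : RepBL V := RepBL_of (values (sval (cid (Nor_generated f)))).

Lemma toBL_values f s : normal s -> generates s f -> RepBL_fun (toBL f) = values s.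
Proof.
move=> ns sf; rewrite /toBL; case: cid => s' [ns' s'f] /=.
rewrite RepBL_ofE; last exact: values_representative.
by congr polylift; apply: funext => n; rewrite (nval_generates ns' ns s'f sf).
Qed.

Lemma toBLX f s n : normal s -> generates s f -> toBL f 'X^n = TAin (nval s n).
Proof. by move=> ns sf; rewrite (toBL_values ns sf) valuesX. Qed.

Lemma toBL_linear : linear toBL.
Proof.
move=> c f g; apply: RepBL_ext => n; rewrite RepBL_evalD.
have [s [ns sf]] := Nor_generated f; have [s' [ns' s'g]] := Nor_generated g.
have nr := normal_add (@normal_scale _ _ c _ ns) ns'.
have rfg : generates (gadd (gscale c s) s') (c *: f + g).
  rewrite /generates Nor_fun_lin sf s'g.
  apply/funext => x; apply: dsumP => t.
  rewrite -[LHS]/(c *: (x t *: gen s t) + x t *: gen s' t).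
  rewrite -[RHS]/((x t : K) *: gen (gadd (gscale c s) s') t).
  by rewrite gen_add gen_scale scalerDr !scalerA mulrC.
rewrite (toBLX _ nr rfg) (toBLX _ ns sf) (toBLX _ ns' s'g).
have [t [a an]] := pdeg_surj n.
by rewrite !(nval_gval _ an) // gval_add gval_scale.
Qed.

Lemma toBL_inj : injective toBL.
Proof.
move=> f g fg; have [s [ns sf]] := Nor_generated f.
have [s' [ns' s'g]] := Nor_generated g.
apply: val_inj; rewrite -[LHS]/(Nor_fun f) -[RHS]/(Nor_fun g) sf s'g.
apply/genhom_gen/nval_gen => // n; apply: TAin_inj.
by rewrite -(toBLX _ ns sf) -(toBLX _ ns' s'g) fg.
Qed.

Lemma generates_label f s : generates s f -> at_leaf f = rlabel s.
Proof.
move=> sf; rewrite /at_leaf sf genhom_tree gen_leaf tpow1_tens.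
exact: scale1r.
Qed.

Lemma epsBL_toBL f : epsBL (toBL f) = eps f.
Proof.
have [s [ns sf]] := Nor_generated f.
rewrite /epsBL /eps (generates_label sf) -(expr0 'X) (toBLX _ ns sf) nval0 //.
by rewrite -TAin_scalar TAcomp_in.
Qed.

Lemma piBL_toBL f : piBL (toBL f) = piV f.
Proof.
have [s [ns sf]] := Nor_generated f.
rewrite /piBL /piV (generates_label sf) -[X in toBL f X]expr1 (toBLX _ ns sf) nval1 //.
by rewrite TAcomp_in tpow1_tens scale1r.
Qed.

Lemma deltaBL_toBL f s : normal s -> generates s f ->
  deltaBL (toBL f) = tmap toBL toBL (delta_family s).
Proof.
move=> ns sf; apply: deltaBL_unique => t u.
rewrite (tmap_sum toBL_linear toBL_linear) pair_eval_family (toBL_values ns sf) values_mul //.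
apply: eq_bigr => j _.
have nl := @normal_child _ _ _ Lft j ns; have nr := @normal_child _ _ _ Rgt j ns.
by rewrite (toBL_values nl (Nor_ofP nl)) (toBL_values nr (Nor_ofP nr)).
Qed.

End NormalValues.

(** * From representative maps to normal trees *)

Section TreeOfRepresentative.
Context {K : fieldType} {V : lmodType K}.
Local Notation R := (RepBL V).
Implicit Types F : R.

(** A node of a generating tree has at least one pair of children, so a zero term
    is put in front of the family. *)
Lemma BL_family_nonempty F : exists n (gh : ('I_n.+1 -> R) * ('I_n.+1 -> R)),
  BL_family F gh.1 gh.2.
Proof.
have [n [g [h FE]]] := BL_family_exists F.
pose pad (g : 'I_n -> R) i := if unlift ord0 i is Some j then g j else 0.
exists n, (pad g, pad h) => t u; rewrite big_ord_recl FE /= {1}/pad unlift_none.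
rewrite mul0r add0r.
by apply: eq_bigr => i _; rewrite /pad !liftK.
Qed.

Definition BL_arity F : nat := sval (cid (BL_family_nonempty F)).
Definition BL_children F : ('I_(BL_arity F).+1 -> R) * ('I_(BL_arity F).+1 -> R) :=
  sval (cid (svalP (cid (BL_family_nonempty F)))).

Lemma BL_childrenP F : BL_family F (BL_children F).1 (BL_children F).2.
Proof. exact: (svalP (cid (svalP (cid (BL_family_nonempty F))))). Qed.

CoFixpoint tree_of F : gentree (lbl V) :=
  GenNode ((piBL F, epsBL F) : lbl V)
    (fun i => tree_of ((BL_children F).1 i)) (fun i => tree_of ((BL_children F).2 i)).

Lemma tree_ofE F : tree_of F = GenNode ((piBL F, epsBL F) : lbl V)
  (fun i => tree_of ((BL_children F).1 i)) (fun i => tree_of ((BL_children F).2 i)).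
Proof.
by rewrite [LHS](_ : _ = let: GenNode x _ l r := tree_of F in GenNode x l r) //;
  case: (tree_of F).
Qed.

Lemma TAvec_tpow1 (y : tpow V 1) : TAvec (tpow1 y) = TAin y.
Proof.
move: y; apply: tensor_ext => [||v c].
- exact: comp_linear (@TAvec_linear _ _) (@tpow1_linear _ _).
- exact: (@TAin_linear K V 1).
rewrite /TAvec tpow1_tens; congr TAin; rewrite tensZl -tensZr; congr tens.
by rewrite /GRing.scale /= mulr1.
Qed.

(** At a leaf the two projections of the label are [f X] and [f 1]; at an inner
    node the recursion for formal values is the product formula for [f]. *)
Lemma gval_tree_of F t (a : ptuple t) : gval (tree_of F) a = F 'X^(pdeg a).
Proof.
elim: t F a => [|u IHu v IHv] F a; rewrite tree_ofE.
  rewrite gval_leaf /TAproj /pdeg /=; case/tupleP: a => b a.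
  rewrite theadE tuple0 /= addn0; case: b => /=.
    rewrite expr1 -[LHS]/(TAvec (piBL F)) TAvec_tpow1 -TAhomogE //.
    by have := graded_mapX 1 (RepBL_graded F); rewrite expr1.
  by rewrite expr0 TAin_scalar RepBL_1.
rewrite gval_node pdeg_node exprD BL_childrenP /=.
by apply: eq_bigr => j _; rewrite IHu IHv.
Qed.

Lemma subtree_tree_of F p s : subtree (tree_of F) p = Some s -> exists F', s = tree_of F'.
Proof.
elim: p F => [|[d i] p IH] F; first by case=> <-; exists F.
by rewrite tree_ofE /=; case: insubP => // j _ _; case: d => /=; apply: IH.
Qed.

(** All subtrees are of the form [tree_of F'], and formal values of such a tree
    depend on the degree only. *)
Lemma tree_of_normal F : normal (tree_of F).
Proof.
move=> p s /subtree_tree_of[F' ->] t u a b ab.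
by rewrite !gval_tree_of ab.
Qed.

Definition ofBL F : Nor V := Nor_of (tree_of F).

Lemma ofBLK : cancel ofBL toBL.
Proof.
move=> F; have nF : normal (tree_of F) := @tree_of_normal F; apply: RepBL_ext => n.
rewrite (toBLX _ nF (Nor_ofP nF)); have [t [a an]] := pdeg_surj n.
by rewrite (nval_gval nF an) gval_tree_of an.
Qed.

Lemma toBLK : cancel toBL ofBL.
Proof. by move=> f; apply: toBL_inj; rewrite ofBLK. Qed.

Lemma ofBL_linear : linear ofBL.
Proof. by move=> c F G; apply: toBL_inj; rewrite toBL_linear !ofBLK. Qed.

(** For every normal tree generating [f], the family of its children is the
    preimage of [deltaBL (toBL f)]; so all these families agree. *)
Lemma delta_toBL f : delta f = tmap ofBL ofBL (deltaBL (toBL f)).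
Proof.
have dE s : normal s -> generates s f ->
    tmap ofBL ofBL (deltaBL (toBL f)) = delta_family s.
  move=> ns sf; rewrite (deltaBL_toBL ns sf) tmap_comp ?tmap_id //.
  - by rewrite (eq_tmap (f' := id) (g' := id)) ?tmap_id //; exact: toBLK.
  - exact: toBL_linear.
  - exact: toBL_linear.
  - exact: ofBL_linear.
  - exact: ofBL_linear.
have [s [ns sf]] := Nor_generated f.
rewrite /delta; case: xgetP => [z _ /(_ s ns sf) ->|none]; first exact/esym/dE.
by case: (none _ dE).
Qed.

End TreeOfRepresentative.

Theorem mainTheorem3 (K : fieldType) (V : lmodType K) :
  (forall (f : Nor V) (s s' : gentree (lbl V)),
     normal s -> normal s' -> generates s f -> generates s' f ->
     forall n : nat, nval s n = nval s' n) /\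
  (exists phi : Nor V -> RepBL V,
     [/\ forall (f : Nor V) (s : gentree (lbl V)),
           normal s -> generates s f ->
           forall n : nat, phi f 'X^n = TAin (nval s n),
         linear phi,
         forall f : Nor V, piBL (phi f) = piV f &
         coalgebra_iso (@delta K V) (@eps K V) (@deltaBL K V) (@epsBL K V) phi]).
Proof.
split; first by move=> f s s' ns ns'; apply: nval_generates.
exists toBL; split=> [f s ns sf n| |f|].
- exact: toBLX.
- exact: toBL_linear.
- exact: piBL_toBL.
have pl := @toBL_linear K V; have il := @ofBL_linear K V.
split=> // [|||f|f].
- apply: (is_coalgebra_transport pl il (@toBLK K V) (@ofBLK K V)).
  + exact: delta_toBL.
  + by move=> f; exact/esym/epsBL_toBL.
  + exact: RepBL_is_coalgebra.
- exact: RepBL_is_coalgebra.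
- by exists ofBL; [exact: toBLK|exact: ofBLK].
- rewrite delta_toBL tmap_comp //.
  by rewrite (eq_tmap (f' := id) (g' := id)) ?tmap_id //; exact: ofBLK.
- exact: epsBL_toBL.
Qed.
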